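(* Let $K,L$ be number fields, let $k,l\ge2$ be integers, and let $A:\mathcal O_K\to\mathcal O_L$ be a $\mathbb Z$-linear map. Then the following statements satisfy the implications (a) $\Leftrightarrow$ (b) $\Rightarrow$ (c): (a) $A(V_{K,k})\subseteq V_{L,l}$. (b) $A(V_{K,k,p})\subseteq V_{L,l,p}$ for all prime numbers $p$; that is, for every prime number $p$ and every $x\in\mathcal O_K$ whose residue class modulo $p^k$ lies in $V_{K,k,p}$, the residue class of $A(x)$ modulo $p^l$ lies in $V_{L,l,p}$. (c) $A$ is the composition $M_\varepsilon\circ\tau$ of (the restriction to $\mathcal O_K$ of) a field homomorphism $\tau:K\to L$ and the multiplication map $M_\varepsilon:x\mapsto\varepsilon x$ for some $\varepsilon\in\mathcal O_L$.
   Context: For a number field $K$ with ring of integers $\mathcal O_K$ and an integer $k$, $V_{K,k}$ is the set of $k$-free integers: the set of $x\in\mathcal O_K$ with $x\notin\mathfrak p^k$ for every (nonzero) prime ideal $\mathfrak p$ of $\mathcal O_K$. For a prime number $p$, $V_{K,k,p}\subseteq\mathcal O_K/p^k\mathcal O_K$ is the set of residue classes modulo $p^k$ that are not divisible by the $k$-th power of any prime ideal dividing $p$ (i.e. classes of $x$ with $x\notin\mathfrak p^k$ for all $\mathfrak p\mid p$). *)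

(* Defs.v *)
From HB Require Import structures.
From mathcomp Require Import all_boot all_order all_algebra all_field.
From mathcomp Require Import boolp classical_sets.

Set Implicit Arguments.
Unset Strict Implicit.
Unset Printing Implicit Defensive.

Import GRing.Theory.
Local Open Scope ring_scope.
Local Open Scope classical_set_scope.
Local Open Scope quotient_scope.

(* A number field is a K : fieldExtType rat, i.e. a finite extension of rat. *)

Section RingOfIntegers.
Variable K : fieldExtType rat.

Definition is_integer : {pred K} :=
  fun x => `[< integralOver (intr : int -> K) x >].

Lemma is_integer_subring_closed : subring_closed is_integer.
Proof.
split=> [|x y /asboolP xZ /asboolP yZ|x y /asboolP xZ /asboolP yZ].
- exact/asboolP/integral1.
- exact/asboolP/integral_sub.
- exact/asboolP/integral_mul.
Qed.

HB.instance Definition _ :=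
  GRing.isSubringClosed.Build K is_integer is_integer_subring_closed.

Record ringOfIntegers : predArgType :=
  RingOfIntegers { integer_val :> K; _ : integer_val \in is_integer }.

HB.instance Definition _ := [isSub for integer_val].
HB.instance Definition _ := [Choice of ringOfIntegers by <:].
HB.instance Definition _ :=
  [SubChoice_isSubComNzRing of ringOfIntegers by <:].

End RingOfIntegers.

Notation "''O_' K" := (ringOfIntegers K)
  (at level 8, K at level 2, format "''O_' K") : type_scope.

Section Ideals.
Variable R : comNzRingType.

Definition ideal_mul (I J : set R) : set R :=
  [set x | exists s : seq (R * R),
     (forall u, u \in s -> I u.1 /\ J u.2) /\ x = \sum_(u <- s) u.1 * u.2].

Definition ideal_pow (I : set R) (k : nat) : set R :=
  iter k (ideal_mul I) [set: R].

(* A prime_idealr is proper by definition, but may be the zero ideal. *)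
Definition nonzero_ideal (P : prime_idealr R) : Prop :=
  exists2 x : R, x \in (P : {pred R}) & x != 0.

Definition multiples (n : nat) : {pred R} :=
  fun x => `[< exists y : R, x = n%:R * y >].

Lemma multiples_zmod_closed n : zmod_closed (multiples n).
Proof.
split=> [|x y /asboolP[a ->] /asboolP[b ->]].
  by apply/asboolP; exists 0; rewrite mulr0.
by apply/asboolP; exists (a - b); rewrite mulrBr.
Qed.

HB.instance Definition _ n :=
  GRing.isZmodClosed.Build R (multiples n) (multiples_zmod_closed n).

(* R/nR as an additive group: the library's quotient ring would require nR to
   be a proper ideal, and only the residue classes themselves are needed. *)
Definition residues (n : nat) : zmodType :=
  {ideal_quot (multiples n : zmodClosed R)}.

Definition residue (n : nat) (x : R) : residues n :=
  \pi_({ideal_quot (multiples n : zmodClosed R)}) x.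

End Ideals.

Section KFree.
Variables (K : fieldExtType rat) (k : nat).

Definition kfree : set 'O_K :=
  [set x | forall P : prime_idealr 'O_K, nonzero_ideal P ->
     ~ ideal_pow [set` (P : {pred 'O_K})] k x].

(* A prime ideal divides p iff it contains p; it is then nonzero. *)
Definition kfree_mod (p : nat) : set (residues 'O_K (p ^ k)) :=
  residue (p ^ k) @`
    [set x | forall P : prime_idealr 'O_K, p%:R \in (P : {pred 'O_K}) ->
       ~ ideal_pow [set` (P : {pred 'O_K})] k x].

End KFree.

Arguments kfree K k : clear implicits.
Arguments kfree_mod K k p : clear implicits.

(* Main.v *)
(* (b) -> (a): every nonzero prime of 'O_L contains a rational prime.

   (a) -> (b): a class x + p ^ m 'O_K satisfying the local condition at p contains a
   k-free integer.  Impose x' = 1 modulo the other small primes and let the remaining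
   freedom range over a box of side N in Z[th], for an integral primitive element th.
   If q is large then 'O_K/q is reduced, so Q ^ 2 meets Z in q ^ 2 Z for each prime Q
   over q; hence a nonzero element of Q ^ 2 has norm at least q ^ 2, and within a cell of
   side about q ^ (2 / n) at most one point lies in Q ^ 2.  As there are at most n primes
   Q over q and the norms are O(N ^ n), the excluded points number at most
   N ^ n / 2 + O(N ^ (n / 2)).

   (b) -> (c): let Q be a degree one prime of 'O_L over a large p.  By (b), the kernel H
   of A modulo Q contains no element prime to p: such an element could be corrected by a
   multiple of p so that its image falls in Q ^ l.  Thus H is covered by the at most
   n < p primes of 'O_K over p, so it is one of them; being an ideal, it gives
   A 1 * A (x * y) = A x * A y modulo Q.  There are infinitely many such Q, so this is
   an equality, and A / A 1 is multiplicative. *)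

Require Import Defs.
From HB Require Import structures.
From mathcomp Require Import all_boot all_order all_algebra all_field.
From mathcomp Require Import zify ring lra.
From mathcomp Require Import perm boolp classical_sets.

Set Implicit Arguments.
Unset Strict Implicit.
Unset Printing Implicit Defensive.

Import Order.TTheory GRing.Theory Num.Theory.
Local Open Scope ring_scope.
Local Open Scope classical_set_scope.

(** * Integers of a number field *)

Section IntegralElements.
Variable K : fieldExtType rat.

Lemma integer_val_inj : injective (@integer_val K).
Proof. exact: val_inj. Qed.

Lemma integer_valD (x y : 'O_K) : integer_val (x + y) = integer_val x + integer_val y.
Proof. exact: (rmorphD val). Qed.

Lemma integer_valB (x y : 'O_K) : integer_val (x - y) = integer_val x - integer_val y.
Proof. exact: (rmorphB val). Qed.

Lemma integer_valM (x y : 'O_K) : integer_val (x * y) = integer_val x * integer_val y.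
Proof. exact: (rmorphM val). Qed.

Lemma integer_valX (x : 'O_K) n : integer_val (x ^+ n) = integer_val x ^+ n.
Proof. exact: (rmorphXn val). Qed.

Lemma integer_val1 : integer_val (1 : 'O_K) = 1.
Proof. exact: (rmorph1 val). Qed.

Lemma integer_val0 : integer_val (0 : 'O_K) = 0.
Proof. exact: (rmorph0 val). Qed.

Lemma integer_val_nat n : integer_val (n%:R : 'O_K) = n%:R.
Proof. exact: (rmorph_nat val). Qed.

Lemma integer_val_int z : integer_val (z%:~R : 'O_K) = z%:~R.
Proof. exact: (rmorph_int val). Qed.

Lemma integer_val_sum I (r : seq I) P (F : I -> 'O_K) :
  integer_val (\sum_(i <- r | P i) F i) = \sum_(i <- r | P i) integer_val (F i).
Proof. exact: (rmorph_sum val). Qed.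

Lemma in_alg_int (z : int) : in_alg K z%:~R = z%:~R.
Proof. exact: (rmorph_int (in_alg K)). Qed.

Lemma num_field_intr_eq0 (z : int) : (z%:~R == 0 :> K) = (z == 0).
Proof. by rewrite -in_alg_int fmorph_eq0 intr_eq0. Qed.

Lemma num_field_natr_eq0 (m : nat) : (m%:R == 0 :> K) = (m == 0)%N.
Proof. by rewrite -[m%:R]/((Posz m)%:~R) num_field_intr_eq0. Qed.

Lemma integer_mulfI (a x y : 'O_K) : a != 0 -> a * x = a * y -> x = y.
Proof.
move=> a0 /(congr1 (@integer_val K)); rewrite !integer_valM => /mulfI h.
by apply/integer_val_inj/h; apply: contra a0 => /eqP va; apply/eqP/integer_val_inj; rewrite integer_val0.
Qed.

Lemma integer_mulf_eq0 (x y : 'O_K) : x * y = 0 -> x = 0 \/ y = 0.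
Proof.
case: (eqVneq x 0) => [->|x0]; first by left.
by move=> xy; right; apply: (integer_mulfI x0); rewrite xy mulr0.
Qed.

Lemma integer_natr_eq0 (m : nat) : (m%:R == 0 :> 'O_K) = (m == 0)%N.
Proof.
rewrite -num_field_natr_eq0 -integer_val_nat -integer_val0; apply/eqP/eqP => [->//|]; exact: integer_val_inj.
Qed.

Lemma algebraic_rat (y : K) :
  exists2 p : {poly int}, p != 0 & root (map_poly intr p) y.
Proof.
have /polyOver1P[p Dp] := minPolyOver 1%AS y.
have [q [a a0 Dq]] := rat_poly_scale p.
have p0 : p != 0.
  by rewrite -(map_poly_eq0 (in_alg K)) -Dp monic_neq0 // monic_minPoly.
exists q.
  by apply: contraNneq p0 => q0; rewrite Dq q0 map_poly0 scaler0.
have := root_minPoly 1%AS y; rewrite Dp Dq map_polyZ rootZ; last first.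
  by rewrite fmorph_eq0 invr_eq0 intr_eq0.
by rewrite -map_poly_comp (eq_map_poly (g := intr)) // => z /=; exact: in_alg_int.
Qed.

(** If c is the leading coefficient of an integer polynomial q of degree N with root y, then c * y
    is a root of c ^ (N - 1) * q(X / c), which is monic with integer coefficients. *)
Lemma integral_multiple (y : K) :
  exists2 m : nat, (0 < m)%N & exists x : 'O_K, integer_val x = m%:R * y.
Proof.
have [q q0 qy] := algebraic_rat y.
pose c := lead_coef q; have c0 : c != 0 by rewrite lead_coef_eq0.
suff cy : c%:~R * y \in @is_integer K.
  exists `|c|%N; first by rewrite absz_gt0.
  have sc : c = Num.sg c * `|c|%N by rewrite -numEsg.
  have {}cy : `|c|%N%:R * y \in @is_integer K.
    rewrite -[_%:R]/((Posz `|c|%N)%:~R) abszE normrEsg intrM -mulrA.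
    by apply: rpredM => //; apply: rpred_int.
  by exists (RingOfIntegers cy).
case Dn: (size q) => [|n]; first by move/eqP: Dn; rewrite size_poly_eq0 (negPf q0).
have qn : q`_n = c by rewrite /c lead_coefE Dn.
case: n => [|n] in Dn qn.
  move/eqP/size_poly1P: Dn => [a a0 Dq]; move: qy.
  by rewrite Dq map_polyC /= rootC num_field_intr_eq0 (negPf a0).
pose r := \poly_(i < n.+2) (if i == n.+1 then 1 else q`_i * c ^+ (n - i)).
have r1 : r`_n.+1 = 1 by rewrite coef_poly ltnSn eqxx.
have sr : size r = n.+2.
  by apply: size_poly_eq; rewrite eqxx oner_neq0.
apply/asboolP; exists r; first by rewrite monicE lead_coefE sr r1.
rewrite /root horner_coef size_map_poly_id0; last first.
  by rewrite lead_coefE sr r1 oner_neq0.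
rewrite sr; move: qy; rewrite /root horner_coef size_map_poly_id0; last first.
  by rewrite num_field_intr_eq0.
rewrite Dn => /eqP qy; apply/eqP.
rewrite -[RHS](mulr0 (c%:~R ^+ n)) -[X in _ = _ * X]qy mulr_sumr.
apply: eq_bigr => i _.
rewrite !coef_map /= coef_poly ltn_ord exprMn mulrA [RHS]mulrA; congr (_ * _).
have [->|ni] := eqVneq (i : nat) n.+1; first by rewrite qn mul1r exprSr.
rewrite intrM rmorphXn /= -mulrA -!exprD subnK; last first.
  by rewrite -ltnS ltn_neqAle ni -ltnS ltn_ord.
by rewrite mulrC.
Qed.

(** In characteristic zero K has a primitive element, and a positive integer multiple of it is
    integral and generates the same field. The degree of K is n + 1, so that square matrices of this
    size form a ring with 1 != 0. *)
Lemma exists_power_basis : exists (n : nat) (th : 'O_K),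
  (forall y : K, exists2 g : {poly rat}, (size g <= n.+1)%N &
     y = horner_alg (integer_val th) g) /\
  (forall g : {poly rat}, (size g <= n.+1)%N ->
     horner_alg (integer_val th) g = 0 -> g = 0).
Proof.
have p0 : [pchar K] =i pred0 by move=> p; rewrite (fmorph_pchar (in_alg K)) pchar_num.
have sepK : separable 1%VS {:K}.
  by apply/separableP => u _; exact: (pcharf0_separable 1%AS p0 u).
have := eq_adjoin_separable_generator sepK (sub1v _).
set z := separable_generator _ _ => Kz.
have [m m0 [th Dth]] := integral_multiple z.
have {}Kz : <<1; integer_val th>>%VS = {:K}%VS.
  apply/eqP; rewrite eqEsubv subvf /= Kz; apply/FadjoinP; split; first exact: sub1v.
  have -> : z = (m%:R : rat)^-1 *: integer_val th.
    rewrite Dth mulr_natl -scaler_nat scalerA mulVf ?scale1r // pnatr_eq0 -lt0n //.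
  by rewrite memvZ ?memv_adjoin.
exists (adjoin_degree 1 (integer_val th)).-1, th; split=> [y|g sg g0].
  have [q Dq] : exists q, Fadjoin_poly 1 (integer_val th) y = map_poly (in_alg K) q.
    exact/polyOver1P/Fadjoin_polyOver.
  exists q; first by rewrite -(size_map_poly (in_alg K)) -Dq size_Fadjoin_poly.
  rewrite -[RHS]/(_.[_]) -Dq Fadjoin_poly_eq //.
  by rewrite Kz memvf.
apply/eqP; rewrite -(map_poly_eq0 (in_alg K)); apply/eqP.
have sg' : (size (map_poly (in_alg K) g) <= adjoin_degree 1 (integer_val th))%N.
  by rewrite size_map_poly.
have := Fadjoin_poly_unique (alg_polyOver 1%AS g) sg' g0.
by rewrite linear0.
Qed.

End IntegralElements.

(** * Evaluation of integer polynomials *)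

Definition zhorner (R : comNzRingType) (th : R) (g : {poly int}) : R :=
  (map_poly intr g).[th].

Section IntEval.
Variables (R : comNzRingType) (th : R).
Implicit Types g h : {poly int}.

Lemma zhornerD g h : zhorner th (g + h) = zhorner th g + zhorner th h.
Proof. by rewrite /zhorner rmorphD hornerD. Qed.

Lemma zhornerN g : zhorner th (- g) = - zhorner th g.
Proof. by rewrite /zhorner rmorphN hornerN. Qed.

Lemma zhornerB g h : zhorner th (g - h) = zhorner th g - zhorner th h.
Proof. by rewrite zhornerD zhornerN. Qed.

Lemma zhornerM g h : zhorner th (g * h) = zhorner th g * zhorner th h.
Proof. by rewrite /zhorner rmorphM hornerM. Qed.

Lemma zhornerC (c : int) : zhorner th c%:P = c%:~R.
Proof. by rewrite /zhorner map_polyC hornerC. Qed.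

Lemma zhornerX : zhorner th 'X = th.
Proof. by rewrite /zhorner map_polyX hornerX. Qed.

Lemma zhornerXn i : zhorner th 'X^i = th ^+ i.
Proof. by rewrite /zhorner map_polyXn hornerXn. Qed.

Lemma zhorner_sum I (r : seq I) (P : pred I) (F : I -> {poly int}) :
  zhorner th (\sum_(i <- r | P i) F i) = \sum_(i <- r | P i) zhorner th (F i).
Proof.
apply: (big_morph _ zhornerD); exact: (zhornerC 0).
Qed.

End IntEval.

(** * Multiplication matrices and the norm *)

Section PowerBasis.
Variables (K : fieldExtType rat) (n : nat) (th : 'O_K).
Hypothesis span : forall y : K, exists2 g : {poly rat}, (size g <= n.+1)%N &
  y = horner_alg (integer_val th) g.
Hypothesis free : forall g : {poly rat}, (size g <= n.+1)%N ->
  horner_alg (integer_val th) g = 0 -> g = 0.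

Definition powcomb (v : 'rV[rat]_n.+1) : K := horner_alg (integer_val th) (rVpoly v).

Lemma powcomb_is_linear : linear powcomb.
Proof. by move=> a u v; rewrite /powcomb !linearP /= mulr_algl. Qed.

HB.instance Definition _ := GRing.isLinear.Build rat _ _ _ powcomb powcomb_is_linear.

Lemma powcomb_inj : injective powcomb.
Proof.
move=> u v /eqP; rewrite -subr_eq0 -linearB /= => /eqP uv0.
have uv : rVpoly (u - v) = 0 by apply: free => //; apply: size_poly.
by apply/eqP; rewrite -subr_eq0 -(rVpolyK (u - v)) uv linear0.
Qed.

Lemma powcomb_surj y : exists v, powcomb v = y.
Proof.
by have [g sg ->] := span y; exists (poly_rV g); rewrite /powcomb poly_rV_K.
Qed.

Definition powcoord (y : K) := sval (cid (powcomb_surj y)).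

Lemma powcoordK : cancel powcoord powcomb.
Proof. by move=> y; apply: (svalP (cid (powcomb_surj y))). Qed.

Lemma powcombE v : powcomb v = \sum_(i < n.+1) v 0 i *: integer_val th ^+ i.
Proof.
rewrite {1}[v]row_sum_delta linear_sum; apply: eq_bigr => i _; rewrite linearZ /=.
congr (_ *: _); rewrite /powcomb rVpoly_delta -[X in X = _]/(horner_alg _ _).
by rewrite rmorphXn /= horner_algX.
Qed.

(** The regular representation of K on row vectors of coordinates in the power basis; norm and trace
    are its determinant and trace. *)
Definition mulmat (y : K) : 'M[rat]_n.+1 := \matrix_(i < n.+1) powcoord (y * integer_val th ^+ i).

Lemma powcombM v y : powcomb (v *m mulmat y) = y * powcomb v.
Proof.
rewrite mulmx_sum_row linear_sum powcombE mulr_sumr; apply: eq_bigr => i _.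
by rewrite linearZ /= rowK powcoordK scalerAr.
Qed.

Lemma mulmat_ext (A B : 'M[rat]_n.+1) : (forall v, powcomb (v *m A) = powcomb (v *m B)) -> A = B.
Proof.
by move=> AB; apply/row_matrixP => i; rewrite !rowE; apply: powcomb_inj.
Qed.

Lemma mulmat_is_zmod_morphism : zmod_morphism mulmat.
Proof.
by move=> x y; apply: mulmat_ext => v; rewrite mulmxBr linearB /= !powcombM mulrBl.
Qed.

Lemma mulmat_is_monoid_morphism : monoid_morphism mulmat.
Proof.
split=> [|x y]; apply: mulmat_ext => v; first by rewrite powcombM mulmx1 mul1r.
by rewrite -mulmxE (mulmxA v) !powcombM [RHS]mulrCA mulrA.
Qed.

HB.instance Definition _ := GRing.isZmodMorphism.Build K 'M[rat]_n.+1 mulmat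
  mulmat_is_zmod_morphism.
HB.instance Definition _ := GRing.isMonoidMorphism.Build K 'M[rat]_n.+1 mulmat
  mulmat_is_monoid_morphism.

Lemma mulmat_alg (a : rat) : mulmat a%:A = a%:M.
Proof.
by apply: mulmat_ext => v; rewrite powcombM mul_mx_scalar linearZ /= mulr_algl.
Qed.

Lemma mulmat_horner y p : mulmat (horner_alg y p) = horner_mx (mulmat y) p.
Proof.
elim/poly_ind: p => [|p c IH]; first by rewrite !rmorph0.
rewrite !rmorphD !rmorphM /= IH horner_algX horner_mx_X horner_algC mulmat_alg.
by rewrite horner_mx_C.
Qed.

Lemma mulmat_neq0_det y : y != 0 -> \det (mulmat y) != 0.
Proof.
move=> y0; suff : mulmat y \in unitmx by rewrite unitmxE unitfE.
have : mulmat y * mulmat y^-1 = 1 by rewrite -rmorphM divff ?rmorph1.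
by move/mulmx1_unit => [].
Qed.

Lemma Cayley_Hamilton_mulmat y : horner_alg y (char_poly (mulmat y)) = 0.
Proof.
by apply: (fmorph_inj mulmat); rewrite rmorph0 [LHS]mulmat_horner Cayley_Hamilton.
Qed.

Local Notation MC y := (map_mx (ratr : rat -> algC) (mulmat y)).

(** A monic integer polynomial that kills x kills its matrix, and so has every eigenvalue as a
    root. *)
Lemma eigenvalue_Aint (x : 'O_K) a : eigenvalue (MC x) a -> a \in Aint.
Proof.
case/eigenvalueP => v Dv v0.
have [p pm px] : integralOver (intr : int -> K) (integer_val x).
  by case: x {Dv} => x /= /asboolP.
have vq q : v *m horner_mx (MC x) q = q.[a] *: v.
  elim/poly_ind: q => [|q c IH]; first by rewrite rmorph0 horner0 mulmx0 scale0r.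
  rewrite rmorphD rmorphM /= horner_mx_X horner_mx_C hornerMXaddC mulmxDr.
  by rewrite -mulmxE mulmxA IH mul_mx_scalar -scalemxAl Dv scalerA scalerDl mulrC.
pose q : {poly rat} := map_poly intr p.
have Dq : map_poly (ratr : rat -> algC) q = map_poly intr p.
  by rewrite -map_poly_comp; apply: eq_map_poly => z /=; rewrite ratr_int.
apply: (@root_monic_Aint (map_poly intr p)); last 2 first.
- exact: monic_map.
- by apply/polyOverP => i; rewrite coef_map /=.
have qx : horner_alg (integer_val x) q = 0.
  rewrite -[LHS]/(_.[_]) -map_poly_comp (eq_map_poly (g := intr)).
    exact/eqP.
  by move=> z /=; exact: in_alg_int.
have := vq (map_poly intr p); rewrite -{1}Dq -map_horner_mx -mulmat_horner qx rmorph0.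
rewrite map_mx0 mulmx0 => /esym/eqP; rewrite scaler_eq0 (negPf v0) orbF.
by move=> h; rewrite /root h.
Qed.

Lemma char_poly_spectrum y : exists2 r : seq algC,
  map_poly ratr (char_poly (mulmat y)) = \prod_(z <- r) ('X - z%:P) &
  forall a, a \in r -> eigenvalue (MC y) a.
Proof.
have [r Dr] := closed_field_poly_normal (char_poly (MC y)).
have := char_poly_monic (MC y); rewrite monicE => /eqP lc.
rewrite lc scale1r in Dr; exists r; first by rewrite map_char_poly Dr.
by move=> a ar; rewrite eigenvalue_root_char Dr root_prod_XsubC.
Qed.

Lemma rat_Aint (c : rat) : (ratr c : algC) \in Aint -> c = (numq c)%:~R.
Proof.
move=> cA; have /intrP[m Dm] := Cint_rat_Aint (Crat_rat c) cA.
suff -> : c = m%:~R by rewrite numq_int.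
by apply: (fmorph_inj (ratr : rat -> algC)); rewrite rmorph_int.
Qed.

(** The coefficients are polynomials in the eigenvalues, hence algebraic integers; being rational,
    they are integers. *)
Lemma char_poly_int (x : 'O_K) :
  exists2 chi : {poly int}, chi \is monic & char_poly (mulmat x) = map_poly intr chi.
Proof.
have [r Dr rA] := char_poly_spectrum x.
have cA i : (char_poly (mulmat x))`_i = (numq (char_poly (mulmat x))`_i)%:~R.
  apply: rat_Aint; rewrite -coef_map /= Dr.
  move: i; apply/polyOverP; rewrite big_seq; apply: rpred_prod => a /rA.
  move=> /eigenvalue_Aint aA.
  by rewrite polyOverXsubC.
pose chi := map_poly numq (char_poly (mulmat x)).
have Dchi : char_poly (mulmat x) = map_poly intr chi.
  by apply/polyP=> i; rewrite coef_map /= coef_map_id0 // -cA.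
exists chi => //; have := char_poly_monic (mulmat x); rewrite {1}Dchi.
by rewrite !monicE (lead_coef_map_inj (@intr_inj rat)) //= -(eqr_int rat _ 1).
Qed.

Lemma zhorner_val (x : 'O_K) g :
  integer_val (zhorner x g) = horner_alg (integer_val x) (map_poly intr g).
Proof.
elim/poly_ind: g => [|g c IH]; first by rewrite /zhorner !rmorph0 horner0 integer_val0.
rewrite zhornerD zhornerM zhornerX zhornerC integer_valD integer_valM integer_val_int IH !rmorphD !rmorphM /=.
by rewrite map_polyX map_polyC /= horner_algX horner_algC -in_alg_int.
Qed.

Lemma char_poly_ez (x : 'O_K) : exists chi : {poly int},
  [/\ chi \is monic, char_poly (mulmat x) = map_poly intr chi & zhorner x chi = 0].
Proof.
have [chi chim Dchi] := char_poly_int x; exists chi; split=> //.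
by apply: integer_val_inj; rewrite zhorner_val -Dchi Cayley_Hamilton_mulmat integer_val0.
Qed.

Lemma zhorner_min (g : {poly int}) : (size g <= n.+1)%N -> zhorner th g = 0 -> g = 0.
Proof.
move=> sg /(congr1 (@integer_val K)); rewrite zhorner_val integer_val0 => /free g0.
apply: (map_inj_poly (@intr_inj rat)) => //; rewrite map_poly0 g0 //.
by rewrite size_map_inj_poly //; exact: intr_inj.
Qed.

(** f is the characteristic polynomial of th. Division by it is possible over the integers because
    it is monic, and a remainder of degree at most n that vanishes at th is zero. *)
Lemma integral_minpoly : exists f : {poly int}, [/\ f \is monic, size f = n.+2,
  zhorner th f = 0 & forall g, zhorner th g = 0 -> exists h, g = h * f].
Proof.
have [f [fm Df f0]] := char_poly_ez th; exists f.
have sf : size f = n.+2.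
  by rewrite -(size_map_inj_poly (@intr_inj rat)) // -Df size_char_poly.
split=> // g g0; exists (Pdiv.CommonRing.rdivp g f).
have := Pdiv.RingMonic.rdivp_eq fm g.
suff -> : Pdiv.CommonRing.rmodp g f = 0 by rewrite addr0.
apply: zhorner_min; first by rewrite -ltnS -sf Pdiv.CommonRing.ltn_rmodp monic_neq0.
have /(congr1 (zhorner th)) := Pdiv.RingMonic.rdivp_eq fm g.
by rewrite zhornerD zhornerM f0 mulr0 add0r g0.
Qed.

(** The norm from K to the rationals; [numq] loses nothing, since the determinant is an integer by
    [det_normz]. *)
Definition normz (x : 'O_K) : int := numq (\det (mulmat x)).

Lemma det_normz (x : 'O_K) : \det (mulmat x) = (normz x)%:~R.
Proof.
have [chi _ Dchi] := char_poly_int x.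
have := char_poly_det (mulmat x); rewrite Dchi coef_map /= => h.
rewrite /normz; have -> : \det (mulmat x) = ((-1) ^+ n.+1 * chi`_0)%:~R.
  by rewrite intrM h rmorph_sign mulrA -expr2 sqrr_sign mul1r.
by rewrite numq_int.
Qed.

Lemma normz_neq0 (x : 'O_K) : x != 0 -> normz x != 0.
Proof.
by move=> x0; rewrite -(intr_eq0 rat) -det_normz mulmat_neq0_det.
Qed.

(** The norm is, up to sign, the constant term of the characteristic polynomial, whose other terms
    at x are multiples of x. *)
Lemma normz_mult (x : 'O_K) : exists w, (normz x)%:~R = x * w.
Proof.
have [chi [_ Dchi chi0]] := char_poly_ez x.
have := char_poly_det (mulmat x); rewrite Dchi coef_map /= det_normz => c0.
have {}c0 : chi`_0 = (-1) ^+ n.+1 * normz x.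
  by apply: (@intr_inj rat); rewrite c0 intrM rmorph_sign.
have Dx : normz x = (-1) ^+ n.+1 * chi`_0.
  by rewrite c0 mulrA -expr2 sqrr_sign mul1r.
pose g := drop_poly 1 chi.
have := poly_take_drop 1 chi; rewrite -/g => Dg.
have t1 : take_poly 1 chi = (chi`_0)%:P.
  by apply/polyP => i; rewrite coef_take_poly coefC; case: i.
move: chi0; rewrite -Dg t1 expr1 zhornerD zhornerC zhornerM zhornerX => /eqP.
rewrite addr_eq0 => /eqP h; exists (- ((-1) ^+ n.+1 * zhorner x g)).
by rewrite Dx intrM h rmorph_sign !mulrN mulrA mulrC.
Qed.

Lemma det_le (m : nat) (A : 'M[rat]_m) (B : rat) :
  (forall i j, `|A i j| <= B) -> `|\det A| <= #|'S_m|%:R * B ^+ m.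
Proof.
move=> AB; rewrite /determinant (le_trans (ler_norm_sum _ _ _)) //.
have -> : #|'S_m|%:R * B ^+ m = \sum_(s : 'S_m) B ^+ m.
  by rewrite sumr_const mulr_natl.
apply: ler_sum => s _; rewrite normrM normrX normrN1 expr1n mul1r normr_prod.
have -> : B ^+ m = \prod_(i < m) B by rewrite prodr_const card_ord.
by apply: ler_prod => i _; rewrite normr_ge0 AB.
Qed.

(** The entries of the multiplication matrix are affine in y, hence at most B * s, and the
    determinant is a signed sum of (n + 1)! products of n + 1 entries. *)
Lemma normz_le (x0 : 'O_K) (D : int) : exists C : nat,
  forall (s : nat) (y : 'I_n.+1 -> int), (0 < s)%N -> (forall i, `|y i| <= s :> int) ->
  `|normz (x0 + D%:~R * \sum_i (y i)%:~R * th ^+ i)| <= (C * s ^ n.+1)%N :> int.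
Proof.
pose l1 (A : 'M[rat]_n.+1) : rat := \sum_i \sum_j `|A i j|.
have l1P (A : 'M[rat]_n.+1) i j : `|A i j| <= l1 A.
  rewrite /l1 (bigD1 i) //= (bigD1 j) //= -addrA lerDl addr_ge0 //.
    by apply: sumr_ge0 => *; apply: normr_ge0.
  by apply: sumr_ge0 => *; apply: sumr_ge0 => *; apply: normr_ge0.
pose B : rat := l1 (mulmat x0) + \sum_(i < n.+1) `|D%:~R| * l1 (mulmat (integer_val th ^+ i)).
have l10 (A : 'M[rat]_n.+1) : 0 <= l1 A by apply: sumr_ge0 => *; apply: sumr_ge0 => *; apply: normr_ge0.
pose E := #|'S_n.+1|%:R * B ^+ n.+1.
have B0 : 0 <= B.
  by rewrite addr_ge0 //; apply: sumr_ge0 => i _; rewrite mulr_ge0.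
exists (Num.bound E) => s y s0 ys.
rewrite -(ler_int rat) -[(Posz _)%:~R]/(_%:R) intr_norm -det_normz natrM natrX.
set x := x0 + _.
suff le_s : forall i j, `|mulmat x i j| <= B * s%:R.
  apply: (le_trans (det_le le_s)); rewrite exprMn mulrA ler_wpM2r ?exprn_ge0 //.
  by apply/ltW/archi_boundP; rewrite mulr_ge0 ?exprn_ge0.
move=> i j.
have -> : mulmat x = mulmat x0 + \sum_k (D * y k)%:~R *: mulmat (integer_val th ^+ k).
  rewrite /x integer_valD rmorphD integer_valM; congr (_ + _).
  have -> : integer_val (\sum_k (y k)%:~R * th ^+ k) =
            \sum_k (y k)%:~R * integer_val th ^+ k.
    rewrite integer_val_sum; apply: eq_bigr => k _.
    by rewrite integer_valM integer_val_int integer_valX.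
  rewrite integer_val_int mulr_sumr rmorph_sum; apply: eq_bigr => k _ /=.
  by rewrite mulrA -intrM -in_alg_int rmorphM /= mulmat_alg -mul_scalar_mx.
rewrite mxE summxE (le_trans (ler_normD _ _)) // /B mulrDl lerD //.
  by apply: (le_trans (l1P _ i j)); rewrite ler_peMr // ler1n.
rewrite (le_trans (ler_norm_sum _ _ _)) // mulr_suml ler_sum // => k _.
rewrite mxE normrM intrM normrM -!mulrA ler_wpM2l // mulrC ler_pM //.
by rewrite -intr_norm -[s%:R]/((Posz s)%:~R) ler_int.
Qed.

(** * Trace form and discriminant *)

Lemma trace_int (x : 'O_K) : exists t : int, \tr (mulmat x) = t%:~R.
Proof.
have [chi _ Dchi] := char_poly_int x.
have := char_poly_trace (mulmat x) (ltn0Sn n); rewrite Dchi coef_map /= => h.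
by exists (- chi`_n); rewrite rmorphN /= h opprK.
Qed.

Lemma trace_spectrum y : exists2 r : seq algC,
  ratr (\tr (mulmat y)) = \sum_(z <- r) z & forall a, a \in r -> eigenvalue (MC y) a.
Proof.
have [r Dr rE] := char_poly_spectrum y; exists r => //.
have sr : size r = n.+1.
  apply/eqP; rewrite -eqSS -(size_prod_XsubC r id) -Dr.
  by rewrite size_map_poly size_char_poly.
have := char_poly_trace (mulmat y) (ltn0Sn n) => /(congr1 (ratr : rat -> algC)).
rewrite -coef_map /= Dr rmorphN /=.
have := @coefPn_prod_XsubC _ r; rewrite sr => ->  //.
by move=> /oppr_inj ->.
Qed.

Lemma eigenvalue_exp x a m : eigenvalue (MC x) a -> eigenvalue (MC (x ^+ m)) (a ^+ m).
Proof.
case/eigenvalueP => v Dv v0; apply/eigenvalueP; exists v => //.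
elim: m => [|m IH].
  by rewrite !expr0 rmorph1 map_mx1 mulmx1 scale1r.
rewrite exprSr rmorphM /= -mulmxE map_mxM mulmxA IH -scalemxAl Dv scalerA.
by rewrite exprSr.
Qed.

(** If x is nilpotent modulo q, so are its eigenvalues among the algebraic integers, and so is their
    sum, the trace t. Then q divides a power of the integer t, hence t. *)
Lemma trace_nilp_mod (x v : 'O_K) (q m : nat) : prime q -> x ^+ m = q%:R * v ->
  exists u : int, \tr (mulmat x) = (q%:Z * u)%:~R.
Proof.
move=> pq Dx; have q0 : (q%:R : algC) != 0 by rewrite pnatr_eq0 -lt0n prime_gt0.
have [r tr_r rE] := trace_spectrum x.
pose nil (a : algC) := a \in Aint /\ exists N, a ^+ N / q%:R \in Aint.
have nilD a b : nil a -> nil b -> nil (a + b).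
  move=> [aA [i ai]] [bA [j bj]]; split; first exact: rpredD.
  exists (i + j)%N; rewrite exprDn mulr_suml rpred_sum // => k _.
  rewrite -mulr_natl -mulrA rpredM ?rpred_nat //.
  have [kj|jk] := leqP k j.
    rewrite mulrAC rpredM ?rpredX //.
    by rewrite -addnBA // exprD mulrAC rpredM // rpredX.
  by rewrite -mulrA rpredM ?rpredX // -(subnKC (ltnW jk)) exprD mulrAC rpredM // rpredX.
have : nil (\sum_(z <- r) z).
  rewrite big_seq; apply: big_rec => [|a b /rE ra]; last apply: nilD.
    by split; [exact: rpred0 | exists 1%N; rewrite expr1 mul0r rpred0].
  split; first exact: eigenvalue_Aint ra.
  exists m; have /eigenvalueP[w Dw w0] := eigenvalue_exp m ra.
  apply: (@eigenvalue_Aint v); apply/eigenvalueP; exists w => //.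
  move: Dw; rewrite -integer_valX Dx integer_valM integer_val_nat rmorphM rmorph_nat /= mulr_natl.
  rewrite raddfMn /= (raddfMn (mulmx w)) /= -scaler_nat => Dw.
  by rewrite mulrC -scalerA -Dw scalerA mulVf // scale1r.
have [t Dt] := trace_int x.
rewrite -tr_r Dt ratr_int => -[_ [N tN]].
have : (t%:~R ^+ N / q%:R : algC) \is a Num.int.
  by apply: Cint_rat_Aint tN; rewrite rpred_div ?rpredX ?rpred_int ?rpred_nat.
case/intrP => u Du.
have {}Du : t ^+ N = q%:Z * u.
  apply: (@intr_inj algC); rewrite intrM -Du rmorphXn /= mulrCA divff ?mulr1 //.
have : (q %| `|t| ^ N)%N.
  by rewrite -abszX Du abszM dvdn_mulr.
rewrite Euclid_dvdX // => /andP[qt _].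
by have /dvdzP[w Dw] : (q %| t)%Z by []; exists w; rewrite Dw mulrC.
Qed.

Lemma mulmat_scale a y : mulmat (a *: y) = a *: mulmat y.
Proof. by rewrite -mulr_algl rmorphM /= mulmat_alg -mul_scalar_mx. Qed.

(** The Gram matrix of the trace form on the power basis; its determinant is the discriminant of
    Z[th]. *)
Definition trmx_pow : 'M[rat]_n.+1 :=
  \matrix_(i < n.+1, j < n.+1) \tr (mulmat (integer_val th ^+ (i + j))).

Lemma trmx_powE v (j : 'I_n.+1) :
  (v *m trmx_pow) 0 j = \tr (mulmat (powcomb v * integer_val th ^+ j)).
Proof.
rewrite mxE powcombE mulr_suml [mulmat _]raddf_sum raddf_sum; apply: eq_bigr => i _.
by rewrite mxE -scalerAl -exprD /= mulmat_scale mxtraceZ.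
Qed.

(** A kernel vector would give a nonzero a with Tr(a * y) = 0 for all y, but y = 1 / a has Tr(1) = n
    + 1. *)
Lemma trmx_pow_det : \det trmx_pow != 0.
Proof.
apply/negP => /det0P[v v0 vT].
have v1 : powcomb v != 0 by rewrite -(linear0 powcomb) (inj_eq powcomb_inj).
have tr0 y : \tr (mulmat (powcomb v * y)) = 0.
  rewrite -[y]powcoordK (powcombE (powcoord y)) mulr_sumr [mulmat _]raddf_sum raddf_sum big1 // => j _ /=.
  by rewrite -scalerAr mulmat_scale mxtraceZ -trmx_powE vT mxE mulr0.
have := tr0 (powcomb v)^-1; rewrite divff // rmorph1 mxtrace1 => /eqP.
by rewrite pnatr_eq0.
Qed.

(** Cramer's rule: the traces of x * th ^ j determine the coordinates of x, with the discriminant as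
    denominator. Taking e = 1 puts d * x in Z[th]; taking e = q turns divisibility of traces by q
    into divisibility of d * x. *)
Lemma disc_mult : exists2 d : nat, (0 < d)%N & forall (x : 'O_K) (e : int),
  (forall j : nat, exists u : int, \tr (mulmat (integer_val (x * th ^+ j))) = (e * u)%:~R) ->
  exists2 g : {poly int}, (size g <= n.+1)%N & d%:R * x = e%:~R * zhorner th g.
Proof.
pose Tz := map_mx numq trmx_pow.
have DT : trmx_pow = map_mx intr Tz.
  apply/matrixP => i j; rewrite !mxE -integer_valX.
  by have [t ->] := trace_int (th ^+ (i + j)); rewrite numq_int.
pose d := \det Tz.
have d0 : d != 0 by rewrite -(intr_eq0 rat) -det_map_mx -DT trmx_pow_det.
exists `|d|%N => [|x e xe]; first by rewrite absz_gt0.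
pose u := \row_(j < n.+1) sval (cid (xe j)).
pose w := u *m \adj Tz.
have vT : powcoord (integer_val x) *m trmx_pow = e%:~R *: map_mx intr u.
  apply/rowP => j; rewrite trmx_powE powcoordK !mxE -integer_valX -integer_valM.
  by case: (cid (xe j)) => /= t ->; rewrite intrM.
have Dw : d%:~R *: powcoord (integer_val x) = e%:~R *: map_mx intr w.
  rewrite /w map_mxM map_mx_adj -DT scalemxAl -vT -mulmxA mul_mx_adj.
  by rewrite mul_mx_scalar DT det_map_mx.
have Dx : d%:~R * x = e%:~R * zhorner th (rVpoly w).
  apply: integer_val_inj; rewrite !integer_valM !integer_val_int zhorner_val map_rVpoly.
  rewrite -[horner_alg _ _]/(powcomb _) !mulrzl -!(@scaler_int rat K) -linearZ -Dw.
  by rewrite [RHS]linearZ /= powcoordK.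
have sw c : (size (c *: rVpoly w : {poly int}) <= n.+1)%N.
  by rewrite (leq_trans (size_scale_leq _ _)) // size_poly.
exists (Num.sg d *: rVpoly w); first exact: sw.
have -> : `|d|%N%:R = (Num.sg d)%:~R * d%:~R :> 'O_K.
  by rewrite -intrM -normrEsg -abszE.
by rewrite -mulrA Dx -mul_polyC zhornerM zhornerC mulrCA.
Qed.

End PowerBasis.

(** * Arithmetic data of an integral primitive element *)

Lemma coprime_bezout (R : comNzRingType) (m n : nat) : coprime m n ->
  exists a b : R, a * m%:R + b * n%:R = 1.
Proof.
rewrite -[coprime m n]/(coprimez m n) => /coprimezP[[a b] /= ab].
by exists a%:~R, b%:~R; rewrite -[m%:R]/((Posz m)%:~R) -[n%:R]/((Posz n)%:~R)
  -!intrM -intrD ab.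
Qed.

Lemma coprime_divr (R : comNzRingType) (q d : nat) (x y : R) : coprime q d ->
  d%:R * x = q%:R * y -> exists w, x = q%:R * w.
Proof.
move=> /(coprime_bezout R)[a [b ab]] dx; exists (a * x + b * y).
rewrite -[x in LHS]mul1r -[X in X * _ = _]ab mulrDl mulrDr -(mulrA b) dx.
by congr (_ + _); rewrite -?mulrA mulrCA.
Qed.

(** The powers of [ib_th] span the subring Z[th], which contains [ib_d] times the ring of integers.
    At primes q not dividing [ib_d] both rings have the same residues, and [ib_reduced] says that q
    is unramified there in the form needed: the ring modulo q is reduced. *)
Record integral_basis (K : fieldExtType rat) := IntegralBasis {
  ib_n : nat;
  ib_th : 'O_K;
  ib_f : {poly int};
  ib_d : nat;
  ib_norm : 'O_K -> int;
  ib_monic : ib_f \is monic;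
  ib_size : size ib_f = ib_n.+2;
  ib_root : zhorner ib_th ib_f = 0;
  ib_min : forall g, zhorner ib_th g = 0 -> exists h, g = h * ib_f;
  ib_d_gt0 : (0 < ib_d)%N;
  ib_index : forall x : 'O_K, exists2 g : {poly int}, (size g <= ib_n.+1)%N &
    ib_d%:R * x = zhorner ib_th g;
  ib_reduced : forall (q m : nat) (x v : 'O_K), prime q -> coprime q ib_d ->
    x ^+ m = q%:R * v -> exists w, x = q%:R * w;
  ib_norm_neq0 : forall x, x != 0 -> ib_norm x != 0;
  ib_norm_mult : forall x, exists w, (ib_norm x)%:~R = x * w;
  ib_norm_le : forall (x0 : 'O_K) (D : int), exists C : nat,
    forall (s : nat) (y : 'I_ib_n.+1 -> int), (0 < s)%N ->
    (forall i, `|y i| <= s :> int) ->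
    `|ib_norm (x0 + D%:~R * \sum_i (y i)%:~R * ib_th ^+ i)|
      <= (C * s ^ ib_n.+1)%N :> int
}.

Lemma exists_integral_basis (K : fieldExtType rat) : inhabited (integral_basis K).
Proof.
have [n [th [span free]]] := exists_power_basis K.
have [f [fm sf f0 fmin]] := integral_minpoly span free.
have [d d0 dP] := disc_mult span free.
apply: (inhabits (@IntegralBasis K n th f d (normz span) fm sf f0 fmin d0 _ _ _ _ _)).
- move=> x; have [|g sg] := dP x 1; last by rewrite mul1r; exists g.
  move=> j; have [u ->] := trace_int span free (x * th ^+ j).
  by exists u; rewrite mul1r.
- move=> q m x v pq cqd xq.
  (* Each x * th ^ j is nilpotent modulo q, so its trace is divisible by q; hence so is d * x, and d
     can be cancelled. *)
  have [j|g _ Dg] := dP x q; last exact: (coprime_divr cqd Dg).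
  apply: (trace_nilp_mod span free (m := m) (v := v * th ^+ (j * m)) pq).
  by rewrite exprMn xq -exprM mulrA.
- exact: (normz_neq0 span free).
- exact: (normz_mult span free).
- exact: (normz_le span free).
Qed.

Local Notation "x ∈ P" := (x \in (P : {pred _})) (at level 70).
Local Notation "P ^: k" := (ideal_pow [set` (P : {pred _})] k) (at level 8).

(** * Prime ideals *)

Section PrimeIdeals.
Variables (R : comNzRingType) (P : prime_idealr R).

Lemma pideal0 : 0 ∈ P. Proof. exact: idealr0. Qed.

Lemma pideal1 : ~ (1 ∈ P). Proof. by rewrite idealr1. Qed.

Lemma pidealD x y : x ∈ P -> y ∈ P -> x + y ∈ P.
Proof. by move=> *; apply: rpredD. Qed.

Lemma pidealB x y : x ∈ P -> y ∈ P -> x - y ∈ P.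
Proof. by move=> *; apply: rpredB. Qed.

Lemma pidealMl x y : y ∈ P -> x * y ∈ P.
Proof. exact: idealMr. Qed.

Lemma pidealMr x y : x ∈ P -> x * y ∈ P.
Proof. by rewrite mulrC; apply: pidealMl. Qed.

Lemma pidealM x y : x * y ∈ P -> x ∈ P \/ y ∈ P.
Proof. by rewrite prime_idealrM => /orP. Qed.

Lemma pidealX x n : x ^+ n ∈ P -> x ∈ P.
Proof.
elim: n => [/pideal1//|n IH]; rewrite exprS => /pidealM[//|]; exact: IH.
Qed.

Lemma pideal_addl x y : x ∈ P -> x + y ∈ P -> y ∈ P.
Proof. by move=> xP /pidealB/(_ xP); rewrite addrC addKr. Qed.

Lemma ipow0 k : P ^: k 0.
Proof.
by case: k => [//|k]; exists [::]; split; rewrite ?big_nil.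
Qed.

Lemma ipowD k x y : P ^: k x -> P ^: k y -> P ^: k (x + y).
Proof.
case: k => [//|k] [s [sP ->]] [t [tP ->]]; exists (s ++ t); rewrite big_cat.
by split=> // u; rewrite mem_cat => /orP[/sP|/tP].
Qed.

Lemma ipowMl k x y : P ^: k y -> P ^: k (x * y).
Proof.
case: k => [//|k] [s [sP ->]]; exists [seq (x * u.1, u.2) | u <- s]; split.
  by move=> _ /mapP[u /sP[uP uk] ->]; split=> //=; apply: pidealMl.
by rewrite big_map mulr_sumr; apply: eq_bigr => u _ /=; rewrite mulrA.
Qed.

Lemma ipowB k x y : P ^: k x -> P ^: k y -> P ^: k (x - y).
Proof. by move=> xk yk; apply: ipowD => //; rewrite -mulN1r; apply: ipowMl. Qed.

Lemma ipowS k x y : x ∈ P -> P ^: k y -> P ^: k.+1 (x * y).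
Proof.
move=> xP yk; exists [:: (x, y)]; split; last by rewrite big_seq1.
by move=> u; rewrite inE => /eqP ->.
Qed.

Lemma ipow_le j k x : (j <= k)%N -> P ^: k x -> P ^: j x.
Proof.
elim: k j x => [|k IH] [|j] x // jk [s [sP ->]].
rewrite big_seq; elim/big_rec: _ => [|u y us yj]; first exact: ipow0.
by apply: ipowD => //; have [uP uk] := sP _ us; apply: ipowS => //; apply: IH uk.
Qed.

Lemma ipow1 x : P ^: 1 x -> x ∈ P.
Proof.
move=> [s [sP ->]]; rewrite big_seq; elim/big_rec: _ => [|u y us yj]; first exact: pideal0.
by have [uP _] := sP _ us; apply: pidealD => //; apply: pidealMr.
Qed.

Lemma ipow_pid k x : (0 < k)%N -> P ^: k x -> x ∈ P.
Proof. by move=> k0 /(ipow_le k0)/ipow1. Qed.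

Lemma ipowX k x : x ∈ P -> P ^: k (x ^+ k).
Proof. by move=> xP; elim: k => // k IH; rewrite exprS; apply: ipowS. Qed.

Lemma ipow_ind2 (S : R -> Prop) : S 0 -> (forall x y, S x -> S y -> S (x + y)) ->
  (forall x y, x ∈ P -> y ∈ P -> S (x * y)) -> forall x, P ^: 2 x -> S x.
Proof.
move=> S0 SD SM _ [s [sP ->]]; rewrite big_seq; elim/big_rec: _ => // u y us Sy.
have [uP /ipow1 u2P] := sP _ us; apply: SD => //; exact: SM.
Qed.

Lemma pideal_coprime (m n : nat) : m%:R ∈ P -> n%:R ∈ P -> ~ coprime m n.
Proof.
move=> mP nP /(coprime_bezout R)[a [b ab]]; apply: pideal1; rewrite -ab.
by apply: pidealD; apply: pidealMl.
Qed.

(** Otherwise a Bezout relation between q and z would put 1 in P. *)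
Lemma pideal_int (q : nat) (z : int) : prime q -> q%:R ∈ P -> z%:~R ∈ P -> (q %| z)%Z.
Proof.
move=> pq qP zP; rewrite -[(q %| z)%Z]/(q %| `|z|)%N; apply: contraT => qz.
case: (@pideal_coprime q `|z|) => //; last by rewrite prime_coprime.
have -> : `|z|%:R = (Num.sg z)%:~R * z%:~R :> R by rewrite -intrM -normrEsg -abszE.
exact: pidealMl.
Qed.

(* If m is prime to q, then m is invertible modulo every power of P. *)
Lemma ipow_coprime (q k m : nat) x : q%:R ∈ P -> coprime q m ->
  P ^: k (m%:R * x) -> P ^: k x.
Proof.
move=> qP cqm mx; have := coprimeXl k cqm => /(coprime_bezout R)[a [b ab]].
rewrite -[x]mul1r -ab mulrDl -!mulrA; apply: ipowD; last exact: ipowMl.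
by apply: ipowMl; rewrite mulrC natrX; apply/ipowMl/ipowX.
Qed.

End PrimeIdeals.

(** * Primes over a rational prime *)

Section PrimesOver.
Variables (K : fieldExtType rat) (B : integral_basis K).
Local Notation n := (ib_n B).
Local Notation th := (ib_th B).
Local Notation d := (ib_d B).

Definition icoef (x : 'O_K) : {poly int} := s2val (cid2 (ib_index B x)).

Lemma icoefP x : d%:R * x = zhorner th (icoef x).
Proof. exact: s2valP' (cid2 (ib_index B x)). Qed.

Lemma size_icoef x : (size (icoef x) <= n.+1)%N.
Proof. exact: s2valP (cid2 (ib_index B x)). Qed.

Lemma zhorner_dvd (q : nat) (g : {poly int}) :
  (forall i : 'I_n.+1, (q %| g`_i)%Z) -> (size g <= n.+1)%N ->
  exists h, zhorner th g = q%:R * zhorner th h.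
Proof.
move=> qg sg; exists (map_poly (fun c => (c %/ q)%Z) g).
rewrite -[q%:R]/((Posz q)%:~R) -(zhornerC th) -zhornerM; congr (zhorner th _).
apply/polyP => i; rewrite coefCM coef_map_id0 ?div0z // mulrC.
have [lt_in|le_ni] := ltnP i n.+1; first by rewrite divzK // (qg (Ordinal lt_in)).
by rewrite nth_default ?div0z ?mul0r // (leq_trans sg).
Qed.

Section OneCharacteristic.
Variables (q : nat) (pq : prime q) (cqd : coprime q d).

(** Since d is invertible modulo q, the coordinates of d * x modulo q determine x modulo q. This
    provides finiteness of the residue ring without forming it. *)
Lemma class_eq (x y : 'O_K) :
  (forall i : 'I_n.+1, (q %| (icoef x)`_i - (icoef y)`_i)%Z) -> exists w, x - y = q%:R * w.
Proof.
move=> qxy; have [h Dh] : exists h, zhorner th (icoef x - icoef y) = q%:R * zhorner th h.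
  apply: zhorner_dvd => [i|]; first by rewrite coefB.
  by rewrite (leq_trans (size_polyD _ _)) // size_polyN geq_max !size_icoef.
by apply: (coprime_divr cqd); rewrite mulrBr !icoefP -zhornerB Dh.
Qed.

Lemma int_Fp_eq0 (z : int) : (z%:~R == 0 :> 'F_q) = (q %| z)%Z.
Proof. by rewrite (dvdz_pcharf (pchar_Fp pq)). Qed.

(** Pigeonhole: among the powers of x, two agree modulo q. *)
Lemma powers_periodic (x : 'O_K) : exists a b w, (0 < b)%N /\
  x ^+ a * (1 - x ^+ b) = q%:R * w.
Proof.
pose cl (y : 'O_K) : 'rV['F_q]_n.+1 := \row_i ((icoef y)`_i)%:~R.
pose N := #|{: 'rV['F_q]_n.+1}|.
have /injectivePn[i [j nij Dij]] : ~~ injectiveb (fun i : 'I_N.+1 => cl (x ^+ i)).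
  by apply/negP => /injectiveP/leq_card; rewrite card_ord ltnn.
wlog ltij : i j nij Dij / (i < j)%N => [W|].
  have [|ltji|eij] := ltngtP i j; [exact: W | |by rewrite (val_inj eij) eqxx in nij].
  by apply: (W j i) => //; rewrite eq_sym.
have [w Dw] : exists w, x ^+ i - x ^+ j = q%:R * w.
  apply: class_eq => k; rewrite -int_Fp_eq0 rmorphB /= subr_eq0; apply/eqP.
  by have /rowP/(_ k) := Dij; rewrite !mxE.
exists i, (j - i)%N, w; rewrite subn_gt0; split=> //.
by rewrite mulrBr mulr1 -exprD subnKC // ltnW.
Qed.

(** For x in P' outside P, periodicity of its powers puts 1 - x ^ b in P, hence in P', and then 1
    lies in P'. *)
Lemma pideal_maximal (P P' : prime_idealr 'O_K) : q%:R ∈ P -> q%:R ∈ P' ->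
  (forall x, x ∈ P -> x ∈ P') -> forall x, x ∈ P' -> x ∈ P.
Proof.
move=> qP qP' PP' x xP'; have [a [b [w [b0 Dw]]]] := powers_periodic x.
have : x ^+ a * (1 - x ^+ b) ∈ P by rewrite Dw; apply: pidealMr.
case/pidealM => [/pidealX//|/PP' xbP']; case: (@pideal1 _ P').
rewrite -[1](subrK (x ^+ b)); apply: pidealD => //.
by case: b b0 {Dw xbP'} => // b _; rewrite exprS; apply: pidealMr.
Qed.

(* The completing factor exists because 'O_K/q is reduced and finite. *)
Lemma pideal_annihilator (P : prime_idealr 'O_K) x : x ∈ P ->
  exists y w, ~ (y ∈ P) /\ y * x = q%:R * w.
Proof.
move=> xP; have [a [b [w [b0 Dw]]]] := powers_periodic x.
have [v Dv] : exists v, x * (1 - x ^+ b) = q%:R * v.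
  (* The power a + 1 of x * (1 - x ^ b) is a multiple of x ^ a * (1 - x ^ b), hence of q. *)
  apply: (ib_reduced (m := a.+1) (v := w * (x * (1 - x ^+ b) ^+ a)) pq cqd).
  by rewrite mulrA -Dw exprMn (exprSr x) (exprS (1 - _)) mulrACA.
exists (1 - x ^+ b), v; split; last by rewrite mulrC.
move=> h; case: (@pideal1 _ P).
rewrite -[1](subrK (x ^+ b)); apply: pidealD => //.
by case: b b0 {Dw Dv h} => // b _; rewrite exprS; apply: pidealMr.
Qed.

(** Completing factors of the single elements are multiplied together; primality keeps the products
    outside P. *)
Lemma pideal_sqr_annihilator (P : prime_idealr 'O_K) x : P ^: 2 x ->
  exists y w, ~ (y ∈ P) /\ y * x = (q ^ 2)%:R * w.
Proof.
move: x; apply: ipow_ind2.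
- by exists 1, 0; split; [exact: pideal1 | rewrite !mulr0].
- move=> x1 x2 [y1 [w1 [y1P D1]]] [y2 [w2 [y2P D2]]].
  exists (y1 * y2), (y2 * w1 + y1 * w2); split; first by case/pidealM.
  have -> : y1 * y2 * (x1 + x2) = y2 * (y1 * x1) + y1 * (y2 * x2).
    by rewrite mulrDr -!mulrA [y1 * (y2 * x1)]mulrCA.
  by rewrite D1 D2 [RHS]mulrDr; congr (_ + _); rewrite mulrCA.
- move=> x1 x2 /pideal_annihilator[y1 [w1 [y1P D1]]] /pideal_annihilator[y2 [w2 [y2P D2]]].
  exists (y1 * y2), (w1 * w2); split; first by case/pidealM.
  by rewrite mulrACA D1 D2 mulrACA expnS expn1 natrM.
Qed.

(** Write z = q * u. Cancelling one q in y * z = q ^ 2 * w leaves y * u = q * w in P with y outside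
    P, so q divides u. *)
Lemma pideal_sqr_int (P : prime_idealr 'O_K) (z : int) : q%:R ∈ P ->
  P ^: 2 z%:~R -> ((q ^ 2)%N %| z)%Z.
Proof.
move=> qP z2; have [y [w [yP Dw]]] := pideal_sqr_annihilator z2.
have /dvdzP[u Du] := pideal_int pq qP (ipow_pid (ltn0Sn 1) z2).
have : y * u%:~R = q%:R * w.
  apply: (@integer_mulfI _ q%:R); first by rewrite integer_natr_eq0 -lt0n prime_gt0.
  have -> : q%:R * (q%:R * w) = (q ^ 2)%:R * w by rewrite natrX expr2 mulrA.
  by rewrite -Dw Du intrM [RHS]mulrA mulrC.
move=> Dyu; have : y * u%:~R ∈ P by rewrite Dyu; apply: pidealMr.
case/pidealM => // /(pideal_int pq qP)/dvdzP[t Dt].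
by apply/dvdzP; exists t; rewrite Du Dt -mulrA -PoszM.
Qed.

(** Distinct primes over q are incomparable, so some y i lies in every Q j except Q i. Such elements
    are independent modulo q, where the dimension is n + 1. *)
Lemma card_primes_over (m : nat) (Q : 'I_m -> prime_idealr 'O_K) :
  (forall i, q%:R ∈ Q i) -> (forall i j, (Q i : {pred _}) =i (Q j : {pred _}) -> i = j) ->
  (m <= n.+1)%N.
Proof.
move=> qQ Qinj; rewrite leqNgt; apply/negP => ltnm.
have [x xP] : exists x : 'I_m -> 'I_m -> 'O_K, forall i j, j != i ->
    x i j ∈ Q j /\ ~ (x i j ∈ Q i).
  suff /choice[x xP] : forall ij : 'I_m * 'I_m, exists z, ij.2 != ij.1 ->
      z ∈ Q ij.2 /\ ~ (z ∈ Q ij.1).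
    by exists (fun i j => x (i, j)) => i j; apply: (xP (i, j)).
  move=> [i j] /=; case: (eqVneq j i) => [|nji]; first by exists 0.
  apply: contrapT => /forallNP h; move/eqP: nji; apply.
  apply: Qinj => z; apply/idP/idP; last first.
    apply: pideal_maximal => // {}z zj; apply: contrapT => zi.
    by apply: (h z).
  by move=> zj; apply: contrapT => zi; apply: (h z).
pose y i := \prod_(j | j != i) x i j.
have yi i : ~ (y i ∈ Q i).
  rewrite /y; elim/big_rec: _ => [|j z ji zi]; first exact: pideal1.
  by case/pidealM => //; case: (xP _ _ ji).
have yj i j : j != i -> y i ∈ Q j.
  by move=> ji; rewrite /y (bigD1 j) //=; apply: pidealMr; case: (xP _ _ ji).
pose A : 'M['F_q]_(m, n.+1) := \matrix_(i, j) ((icoef (y i))`_j)%:~R.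
have : kermx A != 0.
  rewrite kermx_eq0 -row_leq_rank -ltnNge.
  by apply: leq_ltn_trans (rank_leq_col _) _.
case/rowV0Pn => c /sub_kermxP cA c0.
have [i ci] : exists i, c 0 i != 0.
  apply: contrapT => /forallNP h; move/eqP: c0; apply; apply/rowP => i.
  by rewrite mxE; apply/eqP; apply: contrapT => /negP; apply: h.
(* A relation over 'F_q is lifted to integer coefficients: the combination of the y k is then a
   multiple of q, so modulo Q i only the term with k = i remains. *)
pose z := \sum_k (c 0 k : nat)%:R * icoef (y k).
have [h Dh] : exists h, zhorner th z = q%:R * zhorner th h.
  apply: zhorner_dvd => [j|].
    rewrite -int_Fp_eq0 /z coef_sum rmorph_sum /=; apply/eqP.
    transitivity ((c *m A) 0 j); last by rewrite cA mxE.
    rewrite mxE; apply: eq_bigr => k _.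
    rewrite mxE mulr_natl coefMn rmorphMn /= -mulr_natl; congr (_ * _).
    by rewrite natr_Zp.
  rewrite /z; elim/big_rec: _ => [|k p _ IH]; first by rewrite size_poly0.
  rewrite (leq_trans (size_polyD _ _)) // geq_max IH andbT.
  rewrite mulr_natl -scaler_nat.
  by rewrite (leq_trans (size_scale_leq _ _)) // size_icoef.
have Dz : d%:R * \sum_k (c 0 k : nat)%:R * y k = zhorner th z.
  rewrite /z zhorner_sum mulr_sumr; apply: eq_bigr => k _.
  rewrite mulrCA icoefP -[(c 0 k : nat)%:R in RHS]/((Posz (c 0 k))%:~R).
  by rewrite -[_%:~R in RHS](rmorph_int (@polyC int)) intz zhornerM zhornerC.
have [w Dw] := coprime_divr cqd (etrans Dz Dh).
have : (c 0 i : nat)%:R * y i ∈ Q i.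
  apply: (@pideal_addl _ (Q i) (\sum_(k | k != i) (c 0 k : nat)%:R * y k)).
    elim/big_rec: _ => [|k p ki pQ]; first exact: pideal0.
    by apply: pidealD => //; apply: pidealMl; apply: yj; rewrite eq_sym.
  by move: Dw; rewrite (bigD1 i) //= addrC => ->; apply: pidealMr.
case/pidealM => [ciQ|/yi//]; have := pideal_int pq (qQ i) (z := Posz (c 0 i)) ciQ.
rewrite -int_Fp_eq0 -[_%:~R]/((c 0 i : nat)%:R) natr_Zp.
by rewrite (negPf ci).
Qed.

(** A family of pairwise distinct primes over q of maximal size exists by the bound n + 1, and a
    prime missing from it would enlarge it. *)
Lemma primes_over : exists m (Q : 'I_m -> prime_idealr 'O_K),
  [/\ (m <= n.+1)%N, forall i, q%:R ∈ Q i &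
   forall P : prime_idealr 'O_K, q%:R ∈ P -> exists i, forall x, x ∈ P -> x ∈ Q i].
Proof.
pose fam m := `[< exists Q : 'I_m -> prime_idealr 'O_K, (forall i, q%:R ∈ Q i) /\
  forall i j, (Q i : {pred _}) =i (Q j : {pred _}) -> i = j >].
have fam0 : exists m, fam m.
  exists 0%N; apply/asboolP; exists (fun i : 'I_0 => False_rect _ (notF (ltn_ord i))).
  by split=> -[].
have fam_le m : fam m -> (m <= n.+1)%N.
  by case/asboolP => Q [qQ Qinj]; apply: (card_primes_over qQ Qinj).
have [m /asboolP[Q [qQ Qinj]] mmax] := ex_maxnP fam0 fam_le.
exists m, Q; split=> // [|P qP]; first by apply/fam_le/asboolP; exists Q.
apply: contrapT => /forallNP PQ.
have {}PQ i : ~ ((P : {pred _}) =i (Q i : {pred _})).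
  by move=> PQi; apply: (PQ i) => x; rewrite PQi.
suff /mmax : fam m.+1 by rewrite ltnn.
apply/asboolP; exists (fun i => oapp Q P (unlift ord0 i)); split=> [i|i j].
  by case: unliftP => [k _|_] /=; [exact: qQ | exact: qP].
case: unliftP => [i'|] ->; case: unliftP => [j'|] -> //=.
- by move=> /Qinj ->.
- by move=> QP; case: (PQ i') => x; rewrite QP.
- by move=> /PQ.
Qed.

(** Prime avoidance for a set closed under addition only. If h lies in Q m alone and g outside Q m,
    none of the q elements g + c * h is in Q m; two of them in the same Q i would put h in Q i, so
    they need q further primes. *)
Lemma pideal_cover (H : 'O_K -> Prop) (Q : nat -> prime_idealr 'O_K) (m : nat) :
  H 0 -> (forall x y, H x -> H y -> H (x + y)) -> (forall i, q%:R ∈ Q i) ->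
  (m <= q)%N -> (forall x, H x -> exists2 i, (i < m)%N & x ∈ Q i) ->
  exists2 i, (i < m)%N & forall x, H x -> x ∈ Q i.
Proof.
move=> H0 HD qQ; elim: m => [|m IH] mq HQ; first by case: (HQ 0 H0).
have [HQm|] := pselect (forall x, H x -> exists2 i, (i < m)%N & x ∈ Q i).
  by have [i im iP] := IH (ltnW mq) HQm; exists i => //; apply: ltnW.
move=> /existsNP[h /not_implyP[Hh hQ]].
have {}hQ i : (i < m)%N -> ~ (h ∈ Q i) by move=> im hi; apply: hQ; exists i.
have hm : h ∈ Q m.
  have [i] := HQ h Hh; rewrite ltnS leq_eqVlt => /orP[/eqP ->//|im] hi.
  by case: (hQ i im).
have [HQm|] := pselect (forall x, H x -> x ∈ Q m); first by exists m.
move=> /existsNP[g /not_implyP[Hg gQ]].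
have Hc c : H (g + c%:R * h).
  elim: c => [|c IHc]; first by rewrite mul0r addr0.
  by rewrite -addn1 natrD mulrDl mul1r addrA; apply: HD.
have /choice[f fP] : forall c : 'I_q, exists i : 'I_m, g + c%:R * h ∈ Q i.
  move=> c; have [i] := HQ _ (Hc c); rewrite ltnS leq_eqVlt => /orP[/eqP ->|im] ci.
    by case: gQ; apply: (@pideal_addl _ _ (c%:R * h)); [exact: pidealMl | rewrite addrC].
  by exists (Ordinal im).
have finj : injective f.
  move=> c c' fcc; wlog le_cc : c c' fcc / (c <= c')%N => [W|].
    by case: (leqP c c') => [|/ltnW] /W; [apply | move=> ->].
  have : (c' - c)%:R * h ∈ Q (f c).
    rewrite natrB // mulrBl.
    have -> : c'%:R * h - c%:R * h = (g + c'%:R * h) - (g + c%:R * h).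
      by rewrite opprD addrACA subrr add0r.
    by apply: pidealB => //; rewrite fcc.
  case/pidealM => [ccP|hfc]; last by case: (hQ _ (ltn_ord (f c))).
  have := pideal_int pq (qQ _) (z := Posz (c' - c)) ccP.
  rewrite /dvdz /= => /dvdn_leq le_q; apply/val_inj/eqP; rewrite eqn_leq le_cc /=.
  rewrite leqNgt; apply/negP; rewrite -subn_gt0 => /le_q.
  by rewrite leqNgt (leq_ltn_trans (leq_subr _ _)).
by have := leq_card f finj; rewrite !card_ord leqNgt mq.
Qed.

End OneCharacteristic.

(** P contains the norm of a nonzero element, a nonzero integer, and therefore one of its prime
    factors. *)
Lemma nonzero_ideal_prime (P : prime_idealr 'O_K) : nonzero_ideal P ->
  exists2 p : nat, prime p & p%:R ∈ P.
Proof.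
case=> x xP x0; have [w Dw] := ib_norm_mult B x.
have : `|ib_norm B x|%N%:R ∈ P.
  have -> : `|ib_norm B x|%:R = (Num.sg (ib_norm B x))%:~R * (ib_norm B x)%:~R :> 'O_K.
    by rewrite -intrM -normrEsg -abszE.
  by rewrite Dw; apply: pidealMl; apply: pidealMr.
have : (0 < `|ib_norm B x|)%N by rewrite absz_gt0 ib_norm_neq0.
elim/ltn_ind: (absz _) => N IH N0 NP.
have [N1|N1] := leqP N 1.
  by case: (@pideal1 _ P); rewrite (_ : 1 = N%:R) //; case: N N0 N1 {IH NP} => [|[]].
have pN := pdiv_prime N1; have dN := pdiv_dvd N.
have := NP; rewrite -(divnK dN) natrM => /pidealM[NpP|]; last by exists (pdiv N).
apply: (IH (N %/ pdiv N)%N) => //.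
  by rewrite ltn_Pdiv // prime_gt1.
by rewrite divn_gt0 ?prime_gt0 // dvdn_leq.
Qed.

End PrimesOver.

(** * Sieving for k-free elements *)

(** s is the largest side with C * s ^ e < q ^ 2. Maximality gives q ^ 2 <= C * (2 * s) ^ e, which
    bounds the number of cells; the summand q ^ 2 covers the case N < s of a single cell. *)
Lemma cell_side (e C q N : nat) : (0 < e)%N -> (0 < C < q ^ 2)%N -> exists s : nat,
  [/\ (0 < s)%N, (C * s ^ e < q ^ 2)%N &
   ((N %/ s).+1 ^ e * q ^ 2 <= C * 4 ^ e * N ^ e + q ^ 2)%N].
Proof.
move=> e0 /andP[C0 Cq].
have ex : exists s, (C * s ^ e < q ^ 2)%N by exists 1%N; rewrite exp1n muln1.
have bd s : (C * s ^ e < q ^ 2)%N -> (s <= q ^ 2)%N.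
  case: s => // s /ltnW/(leq_trans _) -> //.
  by rewrite (leq_trans _ (leq_pmull _ C0)) // -{1}[s.+1]expn1 leq_pexp2l.
have [s Ps smax] := ex_maxnP ex bd.
have s0 : (0 < s)%N by apply: smax; rewrite exp1n muln1.
have qs : (q ^ 2 <= C * (2 * s) ^ e)%N.
  have : (q ^ 2 <= C * s.+1 ^ e)%N.
    by rewrite leqNgt; apply/negP => /smax; rewrite ltnn.
  move=> /leq_trans; apply; rewrite leq_mul2l leq_exp2r //.
  by apply/orP; right; lia.
exists s; split=> //; case: (leqP s N) => sN; last first.
  by rewrite divn_small // exp1n mul1n leq_addl.
apply: leq_trans (leq_addr _ _).
apply: leq_trans (leq_mul (leqnn _) qs) _.
rewrite mulnCA -expnMn -mulnA -expnMn leq_mul2l leq_exp2r //; apply/orP; right.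
have := leq_trunc_div N s; rewrite mulSn; lia.
Qed.

(** Telescoping with 1 / (t + 1) ^ 2 <= 1 / t - 1 / (t + 1); the result is multiplied by M to stay
    in the natural numbers. *)
Lemma sum_inv_sqr_le (e A M T : nat) (F : nat -> nat) : (0 < M <= T)%N ->
  (forall q, (M < q)%N -> (F q * q ^ 2 <= e * (A + q ^ 2))%N) ->
  (M * \sum_(M <= i < T) F i.+1 <= e * A + e * T * M)%N.
Proof.
move=> /andP[M0 MT] Fq.
pose S t := (\sum_(M <= i < t) F i.+1)%N.
have H : (S T)%:R <= (e * A)%:R * (M%:R^-1 - T%:R^-1) + (e * T)%:R :> rat.
  elim: T MT => [|t IH]; first by rewrite leqn0 => /eqP M0'; rewrite M0' in M0.
  rewrite leq_eqVlt => /orP[/eqP <-|Mt].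
    by rewrite /S big_geq // subrr mulr0 add0r ler0n.
  have {}IH := IH Mt; rewrite /S big_nat_recr //= natrD.
  have t0 : (0 < t)%N by apply: leq_trans M0 Mt.
  have le_F : (F t.+1)%:R <= (e * A)%:R * (t%:R^-1 - t.+1%:R^-1) + e%:R :> rat.
    have t1 : (0 : rat) < t%:R by rewrite ltr0n.
    have u0 : (0 : rat) < t.+1%:R by rewrite ltr0n.
    have -> : t%:R^-1 - t.+1%:R^-1 = (t%:R * t.+1%:R)^-1 :> rat.
      rewrite -[t.+1]addn1 natrD in u0 *.
      by field; rewrite !gt_eqF.
    apply: (@le_trans _ _ ((e * A)%:R / t.+1%:R ^+ 2 + e%:R)).
      rewrite -(ler_pM2r (exprn_gt0 2 u0)) mulrDl divfK ?expf_neq0 ?gt_eqF //.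
      by rewrite -natrX -!natrM -natrD ler_nat -mulnDr Fq.
    rewrite lerD2r ler_wpM2l ?ler0n // lef_pV2 ?posrE ?mulr_gt0 ?exprn_gt0 //.
    by rewrite expr2 ler_wpM2r ?ler_nat // ltW.
  apply: (le_trans (lerD IH le_F)).
  rewrite addrACA -mulrDr [M%:R^-1 - _ + _]addrA subrK -natrD -mulnSr //.
have M1 : (0 : rat) < M%:R by rewrite ltr0n.
rewrite -(ler_nat rat) natrD !natrM -/(S T).
have T0 : (0 : rat) <= T%:R^-1 by rewrite invr_ge0 ler0n.
have E0 : (0 : rat) <= e%:R * A%:R by rewrite mulr_ge0 ?ler0n.
have : (S T)%:R <= e%:R * A%:R * M%:R^-1 + e%:R * T%:R :> rat.
  apply: (le_trans H); rewrite !natrM lerD2r ler_wpM2l //; lra.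
rewrite -(ler_pM2l M1); move=> /le_trans; apply.
rewrite mulrDr mulrCA divff ?gt_eqF // mulr1; lra.
Qed.

Lemma exists_outside (T : finType) (in_prime_square : nat -> pred T) (M N : nat) :
  (\sum_(M <= i < N) #|in_prime_square i| < #|T|)%N ->
  exists y, forall i, (M <= i < N)%N -> ~~ in_prime_square i y.
Proof.
move=> lt; apply: contrapT => /forallNP h; move: lt; apply/negP; rewrite -leqNgt.
rewrite -sum1_card; under [X in (_ <= X)%N]eq_bigr do rewrite -sum1_card big_mkcond.
rewrite exchange_big; apply: leq_sum => y _.
have /existsNP[i /not_implyP[iMN /negP/negPn yi]] := h y.
rewrite (bigD1_seq i) ?mem_index_iota ?iota_uniq //=.
by rewrite -[y \in _]/(in_prime_square i y) yi.
Qed.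

(** The element is x modulo c on the left and 1 modulo w on the right, for every z. *)
Lemma crt_identity (R : comNzRingType) (a b c w x z : R) : a * c + b * w = 1 ->
  x + c * (a - x * a + w * z) = 1 + w * (x * b - b + c * z).
Proof.
by move=> ab; rewrite -[x in x + _]mulr1 -[X in x * X]ab -[X in _ = X + _]ab; ring.
Qed.

(** * Box points in squares of primes *)

Section Sieve.
Variables (K : fieldExtType rat) (B : integral_basis K).
Local Notation n := (ib_n B).
Local Notation th := (ib_th B).
Local Notation d := (ib_d B).
Local Notation nm := (ib_norm B).

Lemma ipow_mono (P P' : prime_idealr 'O_K) k x : (forall x, x ∈ P -> x ∈ P') ->
  P ^: k x -> P' ^: k x.
Proof.
move=> PP'; elim: k x => [|k IH] x // [s [sP ->]]; exists s; split=> // u us.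
by have [uP uk] := sP u us; split; [exact: PP' | exact: IH].
Qed.

Definition box_point (x0 : 'O_K) (D N : nat) (y : {ffun 'I_n.+1 -> 'I_N}) : 'O_K :=
  x0 + D%:R * \sum_i (y i)%:R * th ^+ i.

Lemma th_free (y : 'I_n.+1 -> int) : \sum_i (y i)%:~R * th ^+ i = 0 -> forall i, y i = 0.
Proof.
move=> y0 i; pose g := rVpoly (\row_i y i).
have g0 : zhorner th g = 0.
  rewrite -y0 /g /rVpoly poly_def zhorner_sum; apply: eq_bigr => j _.
  by rewrite -mul_polyC zhornerM zhornerC zhornerXn valK mxE.
have [h Dh] := ib_min g0.
have {}g0 : g = 0.
  apply/eqP; apply: contraT => gn0; have : (size g <= n.+1)%N by apply: size_poly.
  rewrite Dh size_Mmonic ?ib_monic ?ib_size //; last first.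
    by apply: contraNneq gn0 => h0; rewrite Dh h0 mul0r.
  rewrite addnS /= -ltnS -addnS leqNgt -[n.+2]add0n ltn_add2r lt0n size_poly_eq0.
  by move=> /negPn/eqP h0; rewrite Dh h0 mul0r eqxx in gn0.
have := coef_rVpoly_ord (\row_i y i) i.
by rewrite -/g g0 coef0 mxE.
Qed.

Section OnePrime.
Variables (q : nat) (pq : prime q) (cqd : coprime q d).

Definition in_prime_square (x0 : 'O_K) (D N : nat) : pred {ffun 'I_n.+1 -> 'I_N} :=
  fun y => `[< exists P : prime_idealr 'O_K, q%:R ∈ P /\ P ^: 2 (box_point x0 D y) >].

(** A bad point is determined by a prime Q over q whose square contains it and by its cell of side
    s: the difference of two points sharing both is D times an element of Q ^ 2 whose norm is
    divisible by q ^ 2 and smaller than q ^ 2, hence zero. *)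
Lemma card_bad_cells (x0 : 'O_K) (D N C s : nat) : coprime q D ->
  (forall y : 'I_n.+1 -> int, (forall i, `|y i| <= s :> int) ->
    `|nm (\sum_i (y i)%:~R * th ^+ i)| <= (C * s ^ n.+1)%N :> int) ->
  (0 < s)%N -> (C * s ^ n.+1 < q ^ 2)%N ->
  (#|@in_prime_square x0 D N| <= n.+1 * (N %/ s).+1 ^ n.+1)%N.
Proof.
move=> cqD nmC s0 Cs; have [m [Q [mn qQ QP]]] := primes_over pq cqd.
have badQ y : @in_prime_square x0 D N y -> exists i, (Q i) ^: 2 (box_point x0 D y).
  by case/asboolP => P [/QP[i PQ] P2]; exists i; exact: ipow_mono P2.
(* A bad point is set aside only to supply the index i0, the default value of f at good points. *)
have [/eqP->//|/pred0Pn[y0 y0b]] := boolP (#|@in_prime_square x0 D N| == 0)%N.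
have [i0 _] := badQ y0 y0b.
have /choice[f fP] : forall y, exists i, @in_prime_square x0 D N y -> (Q i) ^: 2 (box_point x0 D y).
  move=> y; have [/badQ[i Qi]|] := boolP (@in_prime_square x0 D N y); first by exists i.
  by exists i0.
pose cell (y : {ffun 'I_n.+1 -> 'I_N}) : {ffun 'I_n.+1 -> 'I_(N %/ s).+1} :=
  [ffun i => inord (y i %/ s)].
have finj : {in @in_prime_square x0 D N &, injective (fun y => (f y, cell y))}.
  move=> y y' yb yb' [fyy' cyy'].
  pose z i : int := (y i)%:Z - (y' i)%:Z.
  have zs i : `|z i| <= s.
    have /ffunP/(_ i)/(congr1 val) := cyy'; rewrite !ffunE /= !inordK; last 2 first.
    - by rewrite ltnS leq_div2r // ltnW.
    - by rewrite ltnS leq_div2r // ltnW.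
    move=> e; have := divn_eq (y i) s; have := divn_eq (y' i) s.
    have := ltn_pmod (y i) s0; have := ltn_pmod (y' i) s0.
    by rewrite /z -e; lia.
  have Dz : box_point x0 D y - box_point x0 D y' = D%:R * \sum_i (z i)%:~R * th ^+ i.
    rewrite /box_point opprD addrACA subrr add0r -mulrBr -sumrB; congr (_ * _).
    by apply: eq_bigr => i _; rewrite /z intrB mulrBl.
  have : (Q (f y)) ^: 2 (D%:R * \sum_i (z i)%:~R * th ^+ i).
    by rewrite -Dz; apply: ipowB; [exact: fP | rewrite fyy'; exact: fP].
  move/(ipow_coprime (qQ _) cqD) => zQ.
  have [w Dw] := ib_norm_mult B (\sum_i (z i)%:~R * th ^+ i).
  have nQ : (Q (f y)) ^: 2 (nm (\sum_i (z i)%:~R * th ^+ i))%:~R.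
    by rewrite Dw mulrC; apply: ipowMl.
  have := pideal_sqr_int pq cqd (qQ _) nQ.
  rewrite /dvdz /= => qn; have n0 : nm (\sum_i (z i)%:~R * th ^+ i) = 0.
    apply/eqP; rewrite -absz_eq0; apply: contraT; rewrite -lt0n => n0.
    have := dvdn_leq n0 qn; rewrite leqNgt => /negP; case.
    by apply: leq_ltn_trans Cs; rewrite -lez_nat abszE; exact: nmC.
  have z0 : \sum_i (z i)%:~R * th ^+ i = 0.
    by apply/eqP; apply: contraT => /(ib_norm_neq0 B); rewrite n0.
  apply/ffunP => i; apply/val_inj; have := th_free z0 i.
  by rewrite /z => /eqP; rewrite subr_eq0 => /eqP[].
have le1 := leq_card_in _ _ finj; rewrite card_prod card_ffun !card_ord in le1.
by apply: (leq_trans le1); rewrite leq_mul2r mn orbT.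
Qed.

End OnePrime.
Lemma box_point_inj (x0 : 'O_K) (D N : nat) : (0 < D)%N ->
  injective (@box_point x0 D N).
Proof.
move=> D0 y y' /eqP; rewrite -subr_eq0 /box_point opprD addrACA subrr add0r -mulrBr.
rewrite -sumrB => /eqP/integer_mulf_eq0[/eqP|z0]; first by rewrite integer_natr_eq0 gtn_eqF.
pose z i : int := (y i)%:Z - (y' i)%:Z.
have {}z0 : \sum_i (z i)%:~R * th ^+ i = 0.
  by rewrite -[RHS]z0; apply: eq_bigr => i _; rewrite /z intrB mulrBl.
apply/ffunP => i; apply/val_inj; have := th_free z0 i.
by rewrite /z => /eqP; rewrite subr_eq0 => /eqP[].
Qed.

Lemma kfree_lift (k p m : nat) (x : 'O_K) : (2 <= k <= m)%N -> prime p ->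
  (forall P : prime_idealr 'O_K, p%:R ∈ P -> ~ P ^: k x) ->
  exists y, kfree K k (x + (p ^ m)%:R * y).
Proof.
move=> /andP[k2 km] pp xP; set e := n.+1.
have [C1 hC1] := ib_norm_le B 0 1.
(* The first summand of M makes the main term of the sieve over q > M at most half of the box. The
   others make such q exceed p, d and C0, so that q is prime to p and d and C0 < q ^ 2. *)
pose C0 := C1.+1; pose M := (2 * e * (C0 * 4 ^ e) + p + d + C0)%N.
pose W := (\prod_(q < M.+1 | prime q && (q != p :> nat)) q)%N.
have cWq q : prime q -> (M < q)%N || (q == p) -> coprime q W.
  move=> pq Mq; rewrite /W; elim/big_rec: _ => [|i w /andP[pi ip] IH]; first exact: coprimen1.
  rewrite coprimeMr IH andbT prime_coprime // dvdn_prime2 //.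
  case/orP: Mq => [Mq|/eqP ->]; last by rewrite eq_sym.
  by rewrite gtn_eqF // (leq_trans (ltn_ord i)).
have [a [b ab]] : exists a b : 'O_K, a * (p ^ m)%:R + b * W%:R = 1.
  by apply/coprime_bezout/coprimeXl/cWq => //; rewrite eqxx orbT.
(* Chinese remaindering: x0 is x modulo p ^ m and 1 modulo W, and adding multiples of D = p ^ m * W
   preserves both. *)
pose x0 := x + (p ^ m)%:R * (a - x * a).
pose D := (p ^ m * W)%N.
have W0 : (0 < W)%N by apply: prodn_cond_gt0 => q /andP[pq _]; apply: prime_gt0.
have D0 : (0 < D)%N by rewrite muln_gt0 W0 expn_gt0 prime_gt0.
have [C2 hC2] := ib_norm_le B x0 D.
(* N is a square so that q ^ 2 <= C2 * N ^ e implies q <= C2 * j ^ e <= T. The sieve thus stops near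
   N ^ (e / 2), and j is large enough for the error e * T to be small against N ^ e. *)
pose j := (2 * e * C2 + 2 * e * M + 4)%N; pose N := (j ^ 2)%N.
pose T := (C2 * j ^ e + M)%N; pose A := (C0 * 4 ^ e * N ^ e)%N.
have C00 : (0 < C0)%N by [].
have M0 : (0 < M)%N by rewrite /M; lia.
pose F q := if prime q then #|@in_prime_square q x0 D N| else 0%N.
have hF q : (M < q)%N -> (F q * q ^ 2 <= e * (A + q ^ 2))%N.
  move=> Mq; rewrite /F; case: ifP => // pq.
  have Cq : (0 < C0 < q ^ 2)%N.
    rewrite C00 /= (@leq_trans q) //; first by apply: leq_ltn_trans Mq; rewrite /M leq_addl.
    by rewrite -{1}[q]expn1 leq_pexp2l // prime_gt0.
  have [s [s0 Cs le_s]] := cell_side N (ltn0Sn n) Cq.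
  have cqd : coprime q d.
    rewrite prime_coprime // gtnNdvd ?ib_d_gt0 //.
    by apply: leq_ltn_trans Mq; rewrite /M; lia.
  have cqD : coprime q D.
    rewrite coprimeMr cWq ?Mq // andbT; apply: coprimeXr.
    rewrite prime_coprime // dvdn_prime2 // gtn_eqF //.
    by apply: leq_ltn_trans Mq; rewrite /M; lia.
  have le_nm (y : 'I_n.+1 -> int) : (forall i, `|y i| <= s :> int) ->
      `|nm (\sum_i (y i)%:~R * th ^+ i)| <= (C0 * s ^ e)%N :> int.
    move=> ys; have := hC1 s y s0 ys; rewrite add0r mul1r => /le_trans; apply.
    by rewrite lez_nat leq_mul2r leqnSn orbT.
  have le_bad := card_bad_cells pq cqd x0 N cqD le_nm s0 Cs.
  apply: (leq_trans (leq_mul le_bad (leqnn _))).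
  by rewrite -mulnA leq_mul2l le_s orbT.
have MT : (0 < M <= T)%N by rewrite M0 leq_addl.
have le_sum := sum_inv_sqr_le MT hF.
have N_large : (2 * e * T + 2 < N ^ e)%N.
  have -> : (N ^ e = j ^ e * j ^ e)%N by rewrite /N -expnM mulnC expnM expnS expn1.
  have je : (j <= j ^ e)%N by rewrite -{1}[j]expn1 leq_pexp2l // /j; lia.
  apply: (@leq_trans (j * j ^ e)); last by rewrite leq_mul2r je orbT.
  have je1 : (1 <= j ^ e)%N by rewrite expn_gt0 /j; lia.
  rewrite /T {1}/j; move: (j ^ e)%N je1 => u u1; nia.
have lt_sum : ((\sum_(M <= i < T) F i.+1).+1 < N ^ e)%N.
  have : (2 * e * A <= M * N ^ e)%N.
    by rewrite /A mulnA leq_mul2r; apply/orP; right; rewrite /M; lia.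
  move: le_sum; move: (\sum_(_ <= _ < _) _)%N => S; move: (N ^ e)%N N_large => u hu.
  by rewrite -(ltn_pmul2l M0) => *; nia.
(* Index i stands for the number i + 1; the extra index T excludes the zero element, which at most
   one y produces. *)
pose bad' i : pred {ffun 'I_e -> 'I_N} := fun y =>
  if i == T then box_point x0 D y == 0 else prime i.+1 && in_prime_square i.+1 x0 D y.
have [|y hy] := @exists_outside _ bad' M T.+1.
  rewrite card_ffun !card_ord big_nat_recr ?leq_addl //=.
  apply: leq_ltn_trans lt_sum; rewrite -addn1 leq_add //.
    rewrite !big_nat; apply: leq_sum => i /andP[_ iT]; rewrite /F.
    case: ifP => pi; last first.
      by rewrite eq_card0 // => z; rewrite inE /bad' ltn_eqF // pi.
    by apply/eq_leq/eq_card => z; rewrite /in_mem /= /bad' ltn_eqF // pi.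
  apply/card_le1_eqP => z z'; rewrite /in_mem /= /bad' eqxx => /eqP z0 /eqP z'0.
  by apply: (@box_point_inj x0 _ _ D0); rewrite z0 z'0.
pose z := \sum_i (y i)%:R * th ^+ i.
exists (a - x * a + W%:R * z).
have Dy : x + (p ^ m)%:R * (a - x * a + W%:R * z) = box_point x0 D y.
  by rewrite /box_point /x0 /D mulrDr addrA natrM mulrA.
have y0 : box_point x0 D y != 0.
  by have := hy T; rewrite leq_addl ltnSn /bad' eqxx; apply.
rewrite Dy => P /(nonzero_ideal_prime B)[q pq qP] yk.
(* Three cases: q > M is excluded by the sieve, q = p by the hypothesis on x, and any other q
   divides W, modulo which the point is 1. *)
have [Mq|qM] := ltnP M q.
  have y2 := ipow_le k2 yk.
  (* q ^ 2 divides the nonzero norm of the point, so q lies in the range that was sieved. *)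
  have qT : (q.-1 < T)%N.
    rewrite prednK ?prime_gt0 //.
    have [w Dw] := ib_norm_mult B (box_point x0 D y).
    have nP : P ^: 2 (nm (box_point x0 D y))%:~R by rewrite Dw mulrC; apply: ipowMl.
    have cqd : coprime q d.
      rewrite prime_coprime // gtnNdvd ?ib_d_gt0 //.
      by apply: leq_ltn_trans Mq; rewrite /M; lia.
    have := pideal_sqr_int pq cqd qP nP; rewrite /dvdz /= => /dvdn_leq.
    rewrite absz_gt0 ib_norm_neq0 // => /(_ isT) le_q.
    have j0 : (0 < N)%N by rewrite expn_gt0 /j; lia.
    have le_n : (`|nm (box_point x0 D y)| <= C2 * N ^ e)%N.
      rewrite -lez_nat abszE; apply: (hC2 N (fun i => Posz (y i)) j0) => i.
      by rewrite ger0_norm // lez_nat ltnW.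
    have : (q <= C2 * j ^ e)%N; last by move/leq_trans; apply; rewrite /T leq_addr.
    rewrite -(@leq_exp2r _ _ 2) // (leq_trans le_q) // (leq_trans le_n) //.
    rewrite /N -expnM [(2 * e)%N]mulnC expnM expnMn leq_mul2r; apply/orP; right.
    by case: (C2) => // c; rewrite expnS expn1 leq_pmulr.
  have Mq1 : (M <= q.-1 < T.+1)%N.
    by rewrite ltnS (ltnW qT) andbT -ltnS prednK ?prime_gt0.
  have := hy _ Mq1; rewrite /bad' ltn_eqF // prednK ?prime_gt0 // pq => /asboolP; apply.
  by exists P.
have [eqp|nqp] := eqVneq q p.
  apply: (xP P); first by rewrite -eqp.
  have : P ^: k (x + (p ^ m)%:R * (a - x * a + W%:R * z)) by rewrite Dy.
  move=> /(ipowB (y := (p ^ m)%:R * (a - x * a + W%:R * z))); rewrite addrK; apply.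
  by rewrite mulrC; apply: ipowMl; rewrite natrX; apply: (ipow_le km); apply: ipowX; rewrite -eqp.
have qW : W%:R ∈ P.
  by rewrite /W (bigD1 (Ordinal (qM : (q < M.+1)%N))) ?pq //= natrM; apply: pidealMr.
apply: (@pideal1 _ P).
have := ipow_pid (ltnW k2) yk.
rewrite -Dy.
have -> : x + (p ^ m)%:R * (a - x * a + W%:R * z) =
    1 + W%:R * (x * b - b + (p ^ m)%:R * z).
  exact: crt_identity.
by rewrite addrC => h; apply: (pideal_addl _ h); apply: pidealMr.
Qed.

End Sieve.

(** The choice of representative is immaterial, since p ^ k lies in P ^ k for every P containing
    p. *)
Lemma kfree_modP (K : fieldExtType rat) (k p : nat) (x : 'O_K) :
  kfree_mod K k p (residue (p ^ k) x) <->
  forall P : prime_idealr 'O_K, p%:R ∈ P -> ~ P ^: k x.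
Proof.
split=> [[z zP zx] P pP xk|xP]; last by exists x.
apply: (zP P pP).
have : x - z \in (multiples (p ^ k) : {pred 'O_K}).
  by rewrite Quotient.idealrBE; apply/eqP; rewrite -[LHS]/(residue _ x) -zx.
case/asboolP => y Dxz.
have : P ^: k (x - z).
  by rewrite Dxz mulrC; apply: ipowMl; rewrite natrX; apply: ipowX.
by move/(ipowB xk); rewrite opprB addrC subrK.
Qed.

(** * Prime divisors of polynomial values and Hensel lifting *)

Lemma prime_coprime_above (m : nat) : (0 < m)%N -> exists2 p, prime p & coprime p m.
Proof.
move=> m0; have [p mp pp] := prime_above m; exists p => //.
by rewrite prime_coprime // gtnNdvd.
Qed.

(** Euclid's argument: with c = f(0) nonzero, f(c * m * t) = c * u with u congruent to 1 modulo m,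
    so a prime factor of u is prime to m. If a value is zero, any prime will do. *)
Lemma prime_divisor_of_value (f : {poly int}) (m : nat) : (1 < size f)%N -> (0 < m)%N ->
  exists p : nat, exists r : int, [/\ prime p, coprime p m & (p %| f.[r])%Z].
Proof.
move=> sf m0; have [p0 pp0 cp0] := prime_coprime_above m0.
pose c := f.[0]; have [c0|c0] := eqVneq c 0.
  by exists p0, 0; split; rewrite // -/c c0 dvdz0.
have [h Dh] : exists h, f - c%:P = h * 'X.
  have /factor_theorem[h Dh] : root (f - c%:P) 0 by rewrite /root !hornerE subrr.
  by exists h; rewrite Dh subr0.
have fE t : f.[c * m%:Z * t] = c * (1 + m%:Z * (t * h.[c * m%:Z * t])).
  have := congr1 (horner^~ (c * m%:Z * t)) Dh.
  rewrite hornerD hornerN hornerC hornerM hornerX => /eqP.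
  by rewrite subr_eq => /eqP ->; ring.
(* Away from the finitely many roots of g, the factor u is neither 1 nor -1. *)
pose g := (f - c%:P) * (f + c%:P).
have gn0 : g != 0.
  have sc (e : int) : (size e%:P < size f)%N by apply: leq_ltn_trans (size_polyC_leq1 e) sf.
  by rewrite mulf_neq0 // -size_poly_gt0 -?polyCN size_polyDl ?(ltnW sf) ?sc.
pose z (t : nat) := c * m%:Z * t%:Z.
have [t gt] : exists t, ~~ root g (z t).
  apply: contrapT => /forallNP rg.
  have := @max_poly_roots _ g [seq z t | t <- iota 0 (size g)] gn0.
  rewrite size_map size_iota ltnn => h'; suff : false by []; apply: h'.
    by apply/allP => _ /mapP[t _ ->]; apply: contrapT => /negP; apply: rg.
  have cm0 : c * m%:Z != 0 by rewrite mulf_neq0 // -lt0n.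
  by rewrite map_inj_uniq ?iota_uniq // => i j zij; have [] := mulfI cm0 zij.
pose u := 1 + m%:Z * (t%:Z * h.[z t]).
have fu : f.[z t] = c * u by rewrite fE.
have u1 : `|u|%N != 1%N.
  apply: contra gt => /eqP u1; rewrite /root /g hornerM !hornerE fu mulf_eq0.
  have [->|->] : u = 1 \/ u = -1 by move: (u) u1 => v; lia.
    by rewrite mulr1 subrr eqxx.
  by rewrite mulrN1 addNr eqxx orbT.
have [u0|u0] := eqVneq u 0.
  by exists p0, (z t); split; rewrite // fu u0 mulr0 dvdz0.
have u2 : (1 < `|u|)%N by rewrite ltn_neqAle eq_sym u1 absz_gt0.
exists (pdiv `|u|), (z t); split; first exact: pdiv_prime.
  rewrite prime_coprime ?pdiv_prime //; apply/negP => pm.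
  have : (pdiv `|u| %| 1)%Z.
    have pu : (pdiv `|u| %| u)%Z by apply: pdiv_dvd.
    by move: pu; rewrite rpredDr //; apply: dvdz_mulr.
  by rewrite dvdz1 /= => /eqP p1; have := pdiv_prime u2; rewrite p1.
by rewrite fu dvdz_mull //; apply: pdiv_dvd.
Qed.

Lemma taylor2 (R : comNzRingType) (f : {poly R}) (r h : R) :
  exists g, f.[r + h] = f.[r] + f^`().[r] * h + g * h ^+ 2.
Proof.
elim/poly_ind: f => [|f c [g IH]]; first by exists 0; rewrite deriv0 !horner0; ring.
exists (f^`().[r] + g * (r + h)).
by rewrite derivMXaddC !(hornerD, hornerM, hornerX, hornerC) IH; ring.
Qed.

Lemma hensel (f : {poly int}) (p : nat) (r : int) : prime p ->
  (p %| f.[r])%Z -> ~~ (p %| f^`().[r])%Z ->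
  forall l, exists r', (p %| r' - r)%Z /\ ((p ^ l)%N %| f.[r'])%Z.
Proof.
move=> pp fr dfr; elim=> [|[|l] [r1 [r1r fr1]]]; first by exists r; rewrite subrr.
  by exists r; rewrite subrr expn1.
have {}dfr : ~~ (p %| f^`().[r1])%Z.
  have [g Dg] := taylor2 f^`() r (r1 - r).
  apply: contra dfr => d1; move: Dg; rewrite addrC subrK => Dg.
  move: d1; rewrite Dg -addrA rpredDr // expr2 mulrA -mulrDl.
  exact: dvdz_mull.
have [u Du] := dvdzP fr1.
have : coprimez p f^`().[r1].
  by rewrite /coprimez /gcdz eqz_nat -/(coprime _ _) prime_coprime.
case/coprimezP => -[b a] /= ab.
(* Newton's step: f(r1) = u * p ^ (l + 1), and a inverts f'(r1) modulo p. *)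
exists (r1 + (p ^ l.+1)%:Z * - (u * a)); split.
  rewrite addrAC rpredD //; apply: dvdz_mulr.
  by rewrite expnS PoszM; apply: dvdz_mulr.
have [g ->] := taylor2 f r1 ((p ^ l.+1)%:Z * - (u * a)).
have -> : f.[r1] + f^`().[r1] * ((p ^ l.+1)%:Z * - (u * a)) +
    g * ((p ^ l.+1)%:Z * - (u * a)) ^+ 2 =
  ((p ^ l.+1)%:Z * p%:Z) * (u * b + (p ^ l)%:Z * g * (u * a) ^+ 2).
  rewrite Du expnS PoszM; move/(congr1 ( *%R u)): ab; rewrite mulr1 => {1}<-; ring.
by rewrite -PoszM -expnSr dvdz_mulr.
Qed.

(** * Degree one primes *)

(** As 1 - q is a unit modulo every power of P, z = (z - z * q) + z * q gains one power of P at a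
    time. *)
Lemma ipow_nakayama (R : comNzRingType) (P : prime_idealr R) l (z q : R) : q ∈ P ->
  P ^: l (z - z * q) -> P ^: l z.
Proof.
move=> qP zq; suff H j : (j <= l)%N -> P ^: j z by exact: H.
elim: j => // j IH jl; rewrite -[z](subrK (z * q)); apply: ipowD.
  exact: ipow_le zq.
by rewrite mulrC; apply: ipowS => //; apply/IH/ltnW.
Qed.

Lemma coprimeMn_bezout (R : comNzRingType) (p l m : nat) : coprime p m ->
  exists a b : R, a * m%:R + b * (p ^ l)%:R = 1.
Proof. by move=> cpm; apply: coprime_bezout; rewrite coprime_sym coprimeXl. Qed.

Section DegreeOnePrime.
Variables (L : fieldExtType rat) (B : integral_basis L) (p : nat) (r : int).
Local Notation th := (ib_th B).
Local Notation d := (ib_d B).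
Local Notation f := (ib_f B).
Hypotheses (pp : prime p) (cpd : coprime p d) (pfr : (p %| f.[r])%Z).

(* The kernel of the reduction map 'O_L -> 'F_p sending th to r; the integer D
   only clears denominators of x with respect to the powers of th. *)
Definition deg1_ideal : 'O_L -> bool := fun x => `[< exists (D : nat) (g : {poly int}),
  [/\ coprime p D, D%:R * x = zhorner th g & (p %| g.[r])%Z] >].

(** Two representations of x differ, after cross multiplication, by a multiple of f, and p divides
    f(r). *)
Lemma deg1_idealE (D : nat) (g : {poly int}) x : coprime p D ->
  D%:R * x = zhorner th g -> (x \in deg1_ideal) = (p %| g.[r])%Z.
Proof.
move=> cpD Dx; apply/asboolP/idP => [[D' [g' [cpD' D'x pg']]]|pg]; last by exists D, g.
have [|h Dh] := @ib_min _ B (D'%:Z%:P * g - D%:Z%:P * g').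
  by rewrite zhornerB !zhornerM !zhornerC -Dx -D'x mulrCA subrr.
have := congr1 (horner^~ r) Dh.
rewrite hornerD hornerN !hornerM !hornerC => /eqP; rewrite subr_eq => /eqP e.
have : (p %| D'%:Z * g.[r])%Z by rewrite e rpredD // dvdz_mull.
by rewrite -[(_ %| _ * _)%Z]/(_ %| _)%N abszM Gauss_dvdr.
Qed.

Lemma zhorner_deg1 (g : {poly int}) : (zhorner th g \in deg1_ideal) = (p %| g.[r])%Z.
Proof. by apply: (@deg1_idealE 1); rewrite ?coprimen1 ?mul1r. Qed.

Lemma deg1_ideal_closed : idealr_closed deg1_ideal.
Proof.
split=> [||a u v /asboolP[D1 [g1 [c1 Du p1]]] /asboolP[D2 [g2 [c2 Dv p2]]]].
- have -> : 0 = zhorner th 0%:P :> 'O_L by rewrite zhornerC.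
  by rewrite zhorner_deg1 hornerC.
- have -> : 1 = zhorner th 1%:P :> 'O_L by rewrite zhornerC.
  rewrite zhorner_deg1 hornerC; apply/negP => /=.
  by rewrite -[(_ %| _)%Z]/(_ %| 1)%N dvdn1 absz_nat => /eqP p1; have := prime_gt1 pp; rewrite p1.
have [ga _ Da] := ib_index B a.
rewrite (@deg1_idealE (d * D1 * D2) (D2%:Z%:P * ga * g1 + (d * D1)%:Z%:P * g2)).
- rewrite hornerD !hornerM !hornerC rpredD //; exact: dvdz_mull.
- by rewrite !coprimeMr cpd c1.
rewrite zhornerD !zhornerM !zhornerC -Da -Du -Dv -!pmulrn !natrM; ring.
Qed.

Lemma deg1_ideal_prime : prime_idealr_closed deg1_ideal.
Proof.
move=> u v uv; have [gu _ Du] := ib_index B u; have [gv _ Dv] := ib_index B v.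
rewrite (deg1_idealE cpd Du) (deg1_idealE cpd Dv); move: uv.
rewrite (@deg1_idealE (d * d) (gu * gv)) ?coprimeMr ?cpd //; last first.
  by rewrite zhornerM -Du -Dv natrM mulrACA.
by rewrite hornerM -[(_ %| _ * _)%Z]/(_ %| _)%N abszM Euclid_dvdM.
Qed.

HB.instance Definition _ := isIdealr.Build 'O_L deg1_ideal deg1_ideal_closed.
HB.instance Definition _ := isPrimeIdealrClosed.Build 'O_L deg1_ideal deg1_ideal_prime.

Definition deg1_pid : prime_idealr 'O_L := deg1_ideal.

Lemma deg1_p : p%:R ∈ deg1_pid.
Proof.
by rewrite -[p%:R]/((Posz p)%:~R) -(zhornerC th) [_ \in _]zhorner_deg1 hornerC dvdzz.
Qed.

(* Since r lifts to a root of f modulo p ^ l, th is congruent to an integer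
   modulo the l-th power of the ideal. *)
Lemma deg1_residue l : ~~ (p %| f^`().[r])%Z ->
  forall x : 'O_L, exists c : int, deg1_pid ^: l (x - c%:~R).
Proof.
move=> dfr; have [r1 [r1r fr1]] := hensel pp pfr dfr l.
have dfr1 : ~~ (p %| f^`().[r1])%Z.
  have [g Dg] := taylor2 f^`() r (r1 - r).
  apply: contra dfr => d1; move: Dg d1; rewrite addrC subrK => ->.
  rewrite -addrA rpredDr // expr2 mulrA -mulrDl; exact: dvdz_mull.
have rP : (r1 - r)%:~R ∈ deg1_pid.
  by have [s ->] := dvdzP r1r; rewrite intrM; apply: pidealMl; exact: deg1_p.
have thP : th - r1%:~R ∈ deg1_pid.
  have -> : th - r1%:~R = zhorner th ('X - r%:P) - (r1 - r)%:~R.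
    rewrite zhornerB zhornerX zhornerC intrB; ring.
  by apply: pidealB => //; rewrite [_ \in _]zhorner_deg1 !hornerE subrr dvdz0.
have lin (g : {poly int}) : exists h : {poly int}, g - g.[r1]%:P = h * ('X - r1%:P).
  by apply/factor_theorem; rewrite /root !hornerE subrr.
have [h Dh] := lin f.
have hr : h.[r1] = f^`().[r1].
  have := congr1 (fun g => g^`().[r1]) Dh; rewrite derivB derivC subr0 => ->.
  by rewrite derivM derivXsubC !hornerE subrr mulr0 add0r.
have [h1 Dh1] := lin h.
(* From 0 = f(th) = f(r1) + h(th) * (th - r1), the product h(th) * (th - r1) is divisible by p ^ l;
   and h(th) is f'(r1) modulo the ideal, with inverse a. *)
have thl : deg1_pid ^: l (th - r1%:~R).
  have : coprimez p h.[r1].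
    by rewrite hr /coprimez /gcdz eqz_nat -/(coprime _ _) prime_coprime.
  case/coprimezP => -[b a] /= ab.
  apply: (@ipow_nakayama _ _ l _ (1 - a%:~R * zhorner th h)).
    have -> : 1 - a%:~R * zhorner th h = b%:~R * p%:R - a%:~R * (zhorner th h1 * (th - r1%:~R)).
      have -> : zhorner th h1 * (th - r1%:~R) = zhorner th h - (h.[r1])%:~R.
        have := congr1 (zhorner th) Dh1; rewrite zhornerB zhornerM zhornerC zhornerB zhornerX zhornerC => ->; ring.
      have e : 1 = b%:~R * p%:R + a%:~R * (h.[r1])%:~R :> 'O_L.
        by have := congr1 (fun z : int => z%:~R : 'O_L) ab; rewrite intrD !intrM => ->.
      rewrite [X in X - _ = _]e; ring.
    by apply: pidealB; apply: pidealMl; [exact: deg1_p | exact: pidealMl].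
  have -> : th - r1%:~R - (th - r1%:~R) * (1 - a%:~R * zhorner th h) =
      a%:~R * - (f.[r1])%:~R.
    have := congr1 (zhorner th) Dh; rewrite zhornerB zhornerM zhornerC zhornerB zhornerX zhornerC ib_root => e.
    have -> : - (f.[r1])%:~R = 0 - (f.[r1])%:~R :> 'O_L by rewrite sub0r.
    rewrite e; ring.
  have [s ->] := dvdzP fr1; rewrite intrM -mulNr; do 2!apply: ipowMl.
  by rewrite -[_%:~R]/((p ^ l)%:R) natrX; apply: ipowX; exact: deg1_p.
move=> x; have [g _ Dx] := ib_index B x; have [h2 Dh2] := lin g.
(* d * x is the integer g(r1) modulo the power of the ideal, and a inverts d modulo p ^ l. *)
have [a [b ab]] := coprimeMn_bezout int l cpd.
exists (a * g.[r1]).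
have -> : x - (a * g.[r1])%:~R =
    a%:~R * (zhorner th h2 * (th - r1%:~R)) + (b%:~R * x) * (p ^ l)%:R.
  have := congr1 (zhorner th) Dh2; rewrite zhornerB zhornerM zhornerC zhornerB zhornerX zhornerC -Dx => <-.
  have e : 1 = a%:~R * d%:R + b%:~R * (p ^ l)%:R :> 'O_L.
    have := congr1 (fun z : int => z%:~R : 'O_L) ab.
    by rewrite intrD !intrM !natz => ->.
  rewrite intrM -[X in X - _ = _]mul1r [X in X * x - _ = _]e; ring.
apply: ipowD; first by do 2!apply: ipowMl.
by apply: ipowMl; rewrite natrX; apply: ipowX; exact: deg1_p.
Qed.

End DegreeOnePrime.

(** A prime p dividing some f(r) gives a degree one prime Q. Taking p prime to the norm of w *
    f'(th) keeps both factors outside Q, so r is a simple root modulo p and lifts to all powers. *)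
Lemma exists_deg1_prime (L : fieldExtType rat) (B : integral_basis L) (w : 'O_L)
    (m l : nat) : w != 0 -> (0 < m)%N ->
  exists (p : nat) (Q : prime_idealr 'O_L), [/\ prime p, coprime p m, p%:R ∈ Q,
    ~ (w ∈ Q) & forall x : 'O_L, exists c : int, Q ^: l (x - c%:~R)].
Proof.
move=> w0 m0; pose f := ib_f B; pose w1 := w * zhorner (ib_th B) f^`().
have df0 : zhorner (ib_th B) f^`() != 0.
  apply/eqP => /ib_min[h Dh].
  have f'0 : f^`() != 0.
    have /(congr1 (fun c : int => c != 0)) := coef_deriv f (ib_n B).
    have := ib_monic B; rewrite monicE lead_coefE ib_size /= => /eqP ->.
    rewrite -mulr_natr mul1r pnatr_eq0 => h0; apply: contraL isT => /eqP f0.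
    by move: h0; rewrite f0 coef0 eqxx.
  have : (size f^`() < size f)%N by apply: lt_size_deriv; rewrite monic_neq0 ?ib_monic.
  rewrite Dh size_Mmonic ?ib_monic //; last first.
    by apply: contraNneq f'0 => h0; rewrite Dh h0 mul0r.
  rewrite -/f; have : (0 < size h)%N.
    by rewrite size_poly_gt0; apply: contraNneq f'0 => h0; rewrite Dh h0 mul0r.
  by case: (size h) => // s _; rewrite addSn /= ltnNge leq_addl.
have w10 : w1 != 0.
  apply/negP => /eqP/integer_mulf_eq0[] /eqP; [exact/negP | exact/negP].
pose N := ib_norm B w1.
have N0 : N != 0 by apply: ib_norm_neq0.
have M0 : (0 < m * (ib_d B * `|N|))%N by rewrite !muln_gt0 m0 ib_d_gt0 absz_gt0.
have sf : (1 < size f)%N by rewrite /f ib_size.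
have [p [r [pp cp pfr]]] := prime_divisor_of_value sf M0.
move: cp; rewrite !coprimeMr => /and3P[cpm cpd cpN].
pose Q := deg1_pid pp cpd pfr.
have w1Q : ~ (w1 ∈ Q).
  move=> w1Q; have [v Dv] := ib_norm_mult B w1.
  have NQ : (ib_norm B w1)%:~R ∈ Q by rewrite Dv; apply: pidealMr.
  have := pideal_int pp (deg1_p pp cpd pfr) NQ; rewrite -/N -[(_ %| _)%Z]/(_ %| _)%N.
  by apply/negP; rewrite -prime_coprime.
exists p, Q; split=> //; [exact: deg1_p | by move=> wQ; apply: w1Q; apply: pidealMr |].
apply: deg1_residue; apply/negP => pdf; apply: w1Q; apply: pidealMl.
by rewrite [_ \in _](zhorner_deg1 pfr).
Qed.

(** * Maps preserving k-free integers *)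

Lemma nonzero_ideal_over (K : fieldExtType rat) (P : prime_idealr 'O_K) (p : nat) :
  prime p -> p%:R ∈ P -> nonzero_ideal P.
Proof.
by move=> pp pP; exists p%:R => //; rewrite integer_natr_eq0 -lt0n prime_gt0.
Qed.

Section KFreeMaps.
Variables (K L : fieldExtType rat) (k l : nat).
Hypotheses (hk : (2 <= k)%N) (hl : (2 <= l)%N).
Variable A : {additive 'O_K -> 'O_L}.
Variables (BK : integral_basis K) (BL : integral_basis L).

Lemma additive_natl (m : nat) x : A (m%:R * x) = m%:R * A x.
Proof. by rewrite !mulr_natl raddfMn. Qed.

Lemma additive_intl (m : int) x : A (m%:~R * x) = m%:~R * A x.
Proof. by rewrite !mulrzl raddfMz. Qed.

Lemma kfree_mod_of_kfree : A @` kfree K k `<=` kfree L l ->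
  forall p : nat, prime p -> forall x : 'O_K,
    kfree_mod K k p (residue (p ^ k) x) -> kfree_mod L l p (residue (p ^ l) (A x)).
Proof.
move=> HA p pp x /kfree_modP xP; apply/kfree_modP => P pP Axl.
(* Lifting modulo p to the power max(k, l) changes A x only by a multiple of p ^ l. *)
have km : (2 <= k <= maxn k l)%N by rewrite hk leq_maxl.
have [y yP] := kfree_lift BK km pp xP.
have : kfree L l (A (x + (p ^ maxn k l)%:R * y)) by apply: HA; exists (x + (p ^ maxn k l)%:R * y).
apply; first exact: nonzero_ideal_over pP.
rewrite raddfD /= additive_natl; apply: ipowD => //.
rewrite mulrC; apply: ipowMl; rewrite natrX; apply: (ipow_le (leq_maxr k l)).
exact: ipowX.
Qed.

Lemma kfree_of_kfree_mod : (forall p : nat, prime p -> forall x : 'O_K,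
    kfree_mod K k p (residue (p ^ k) x) -> kfree_mod L l p (residue (p ^ l) (A x))) ->
  A @` kfree K k `<=` kfree L l.
Proof.
move=> HA _ [x xk <-] P /(nonzero_ideal_prime BL)[p pp pP].
apply: (proj1 (kfree_modP l p (A x)) _ P pP); apply: HA => //.
apply/kfree_modP => P' pP'; apply: xk.
exact: nonzero_ideal_over pP'.
Qed.

Section LocalCondition.
Hypothesis HA : forall p : nat, prime p -> forall x : 'O_K,
  kfree_mod K k p (residue (p ^ k) x) -> kfree_mod L l p (residue (p ^ l) (A x)).

(** The contrapositive of (b) at p, with the k-th power of P' weakened to P' itself. *)
Lemma local_condition p x (P : prime_idealr 'O_L) : prime p -> p%:R ∈ P ->
  P ^: l (A x) -> exists2 P' : prime_idealr 'O_K, p%:R ∈ P' & x ∈ P'.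
Proof.
move=> pp pP Axl; apply: contrapT => h.
apply: (proj1 (kfree_modP l p (A x)) _ P pP Axl); apply: HA => //.
apply/kfree_modP => P' pP' xk; apply: h; exists P' => //.
by apply: ipow_pid xk; apply: ltnW.
Qed.

Lemma A_one_neq0 : A 1 != 0.
Proof.
have [p [Q [pp _ pQ _ _]]] := exists_deg1_prime BL l (oner_neq0 _) (ltn0Sn 0).
apply/eqP => A10; have [|P' _ /pideal1] := local_condition (x := 1) pp pQ _ => //.
by rewrite A10; apply: ipow0.
Qed.

(* Modulo a degree one prime Q, the kernel of A is an additive subgroup of index p
   all of whose elements lie in primes over p, hence it is one of these primes. *)
Lemma preim_deg1_prime (p : nat) (Q : prime_idealr 'O_L) : prime p ->
  coprime p (ib_d BK) -> (ib_n BK < p)%N -> p%:R ∈ Q -> ~ (A 1 ∈ Q) ->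
  (forall x : 'O_L, exists c : int, Q ^: l (x - c%:~R)) ->
  exists2 P : prime_idealr 'O_K, p%:R ∈ P & forall x, A x ∈ Q <-> x ∈ P.
Proof.
move=> pp cpd np pQ A1Q Qres.
have l0 : (0 < l)%N by apply: ltnW.
have [a1 A1l] := Qres (A 1).
have pa1 : ~~ (p %| a1)%Z.
  apply/negP => /dvdzP[s Ds]; apply: A1Q; rewrite -[A 1](subrK a1%:~R).
  by apply: pidealD; [exact: ipow_pid A1l | rewrite Ds intrM; apply: pidealMl].
have cpa1 : coprime p `|a1| by rewrite prime_coprime.
have [u [v uv]] : exists u v : int, u * a1 + v * (p ^ l)%N = 1.
  have : coprimez (p ^ l)%N a1 by rewrite /coprimez /gcdz eqz_nat -/(coprime _ _) coprimeXl.
  by case/coprimezP => -[v u] /= uv; exists u, v; rewrite addrC.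
(* u inverts a1, the residue of A 1, modulo p ^ l; subtracting the integer c * u from x cancels the
   residue c of A x. *)
have lift x c : Q ^: l (A x - c%:~R) -> Q ^: l (A (x - (c * u)%:~R)).
  move=> xc; rewrite raddfB /= -[(c * u)%:~R]mulr1 additive_intl.
  have -> : A x - (c * u)%:~R * A 1 = (A x - c%:~R) -
      ((c * u)%:~R * (A 1 - a1%:~R) - (c * v)%:~R * (p ^ l)%:R).
    have e : c%:~R = (c * u)%:~R * a1%:~R + (c * v)%:~R * (p ^ l)%:R :> 'O_L.
      have {1}-> : c = c * u * a1 + c * v * (p ^ l)%N by rewrite -!mulrA -mulrDr uv mulr1.
      by rewrite intrD [in LHS]intrM [X in _ + X = _]intrM.
    rewrite [X in _ - X - _]e; ring.
  apply: ipowB => //; apply: ipowB; apply: ipowMl => //.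
  by rewrite natrX; apply: ipowX.
pose H x := A x ∈ Q.
have [m [P [mn pP PP]]] := primes_over pp cpd.
have HP x : H x -> exists i, x ∈ P i.
  move=> Hx; have [c xc] := Qres (A x).
  (* For x in H the correction c * u is divisible by p, so x and its corrected form lie in the same
     primes over p. *)
  have pc : (p %| c)%Z.
    apply: (pideal_int pp pQ).
    by have := pidealB Hx (ipow_pid l0 xc); rewrite opprB addrC subrK.
  have [P' pP' xP'] := local_condition pp pQ (lift x c xc).
  have [i P'i] := PP P' pP'; exists i; apply: P'i.
  rewrite -[x](subrK (c * u)%:~R); apply: pidealD => //.
  by have [s ->] := dvdzP pc; rewrite mulrAC intrM; apply: pidealMl.
have H0 : H 0 by rewrite /H raddf0; apply: pideal0.
have HD x y : H x -> H y -> H (x + y) by rewrite /H raddfD; apply: pidealD.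
case: m => [|m] in P mn pP PP HP; first by case: (HP 0 H0) => -[].
have [||i im Hi] := @pideal_cover _ _ pp H (fun i => P (inord i)) m.+1 H0 HD _ (leq_trans mn np).
- by move=> i; apply: pP.
- by move=> x /HP[i xi]; exists i => //; rewrite inord_val.
exists (P (inord i)) => // x; split=> [/Hi//|xP].
(* Conversely, every x differs from an element of H by the integer c * u; if x is in P, so is that
   integer, and then p divides it. *)
have [c xc] := Qres (A x).
have xcP : x - (c * u)%:~R ∈ P (inord i) by apply/Hi/(ipow_pid l0)/lift.
have cuP : (c * u)%:~R ∈ P (inord i).
  by have := pidealB xP xcP; rewrite opprB addrC subrK.
rewrite -[x](subrK (c * u)%:~R) raddfD; apply: pidealD; first exact/(ipow_pid l0)/lift.
have [s ->] := dvdzP (pideal_int pp (pP _) cuP).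
by rewrite -[(s * p)%:~R]mulr1 additive_intl intrM mulrAC; apply: pidealMl.
Qed.

Lemma A_multiplicative x y : A 1 * A (x * y) = A x * A y.
Proof.
apply/eqP; rewrite -subr_eq0; apply: contraT => w0; exfalso.
set w := A 1 * A (x * y) - A x * A y in w0.
have w10 : A 1 * w != 0.
  apply/negP => /eqP/integer_mulf_eq0[] /eqP; apply/negP => //; exact: A_one_neq0.
(* Being prime to the factorial forces p above the degree bound on the number of primes over p. *)
have m0 : (0 < ib_d BK * (ib_n BK).+1`!)%N by rewrite muln_gt0 ib_d_gt0 fact_gt0.
have [p [Q [pp cp pQ wQ Qres]]] := exists_deg1_prime BL l w10 m0.
move: cp; rewrite coprimeMr => /andP[cpd cpn].
have np : (ib_n BK < p)%N.
  rewrite ltnNge; apply/negP => pn; move: cpn; rewrite prime_coprime // => /negP; apply.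
  by apply: dvdn_fact; rewrite prime_gt0 // ltnW.
have A1Q : ~ (A 1 ∈ Q) by move=> A1Q; apply: wQ; apply: pidealMr.
have [P pP AP] := preim_deg1_prime pp cpd np pQ A1Q Qres.
apply: wQ; apply: pidealMl.
have l0 : (0 < l)%N by apply: ltnW.
have [a1 /(ipow_pid l0) Da1] := Qres (A 1).
have [ay /(ipow_pid l0) Day] := Qres (A y).
(* With integer residues a1 and ay of A 1 and A y, this combination is in the kernel modulo Q; as
   the kernel is an ideal, x times it is there too, which is the desired relation modulo Q. *)
have zP : a1%:~R * y - ay%:~R * 1 ∈ P.
  apply/AP; rewrite raddfB /= !additive_intl.
  have -> : a1%:~R * A y - ay%:~R * A 1 =
    a1%:~R * (A y - ay%:~R) - ay%:~R * (A 1 - a1%:~R) by ring.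
  by apply: pidealB; apply: pidealMl.
have : A (x * (a1%:~R * y - ay%:~R * 1)) ∈ Q by apply/AP/pidealMl.
have -> : x * (a1%:~R * y - ay%:~R * 1) = a1%:~R * (x * y) - ay%:~R * x by ring.
rewrite raddfB /= !additive_intl => xzQ.
have -> : w = (A 1 - a1%:~R) * A (x * y) - (A y - ay%:~R) * A x +
    (a1%:~R * A (x * y) - ay%:~R * A x) by rewrite /w; ring.
by apply: pidealD => //; apply: pidealB; apply: pidealMr.
Qed.

(** The extension of A / A 1 to K by clearing denominators; [frac_AE] shows that the chosen
    denominator is immaterial. *)
Definition frac_A (y : K) : L :=
  let: exist2 m _ xP := cid2 (integral_multiple y) in
  integer_val (A (sval (cid xP))) / (m%:R * integer_val (A 1)).

Lemma frac_AE (m : nat) (x : 'O_K) (y : K) : (0 < m)%N ->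
  integer_val x = m%:R * y ->
  integer_val (A x) = m%:R * integer_val (A 1) * frac_A y.
Proof.
move=> m0 Dx; rewrite /frac_A; case: cid2 => m' m'0 [x' Dx'] /=; case: cid => {}x' /= {}Dx'.
have A1 : integer_val (A 1) != 0 by exact: A_one_neq0.
have m'L : m'%:R != 0 :> L by rewrite num_field_natr_eq0 -lt0n.
have : A (m'%:R * x) = A (m%:R * x').
  congr (A _); apply: integer_val_inj; rewrite !integer_valM !integer_val_nat Dx Dx'; ring.
rewrite !additive_natl => /(congr1 (@integer_val L)); rewrite !integer_valM !integer_val_nat => e.
apply: (mulfI m'L); rewrite e; field.
by rewrite A1.
Qed.

Lemma frac_A_zmod_morphism : zmod_morphism frac_A.
Proof.
move=> y z; have [m m0 [x Dx]] := integral_multiple y.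
have [m' m'0 [x' Dx']] := integral_multiple z.
have A1 : integer_val (A 1) != 0 by exact: A_one_neq0.
have mm0 : (0 < m * m')%N by rewrite muln_gt0 m0.
have Dw : integer_val (m'%:R * x - m%:R * x') = (m * m')%:R * (y - z).
  rewrite integer_valB !integer_valM !integer_val_nat Dx Dx' natrM; ring.
have := frac_AE mm0 Dw.
have -> : A (m'%:R * x - m%:R * x') = m'%:R * A x - m%:R * A x'.
  by rewrite raddfB /= !additive_natl.
rewrite integer_valB !integer_valM !integer_val_nat.
rewrite (frac_AE m0 Dx) (frac_AE m'0 Dx') => e.
have mA : (m * m')%:R * integer_val (A 1) != 0 by rewrite mulf_neq0 // num_field_natr_eq0 -lt0n.
apply: (mulfI mA); rewrite -e natrM; ring.
Qed.

Lemma frac_A_monoid_morphism : monoid_morphism frac_A.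
Proof.
have A1 : integer_val (A 1) != 0 by exact: A_one_neq0.
split=> [|y z].
  have := @frac_AE 1 1 1 isT; rewrite integer_val1 !mul1r => /(_ erefl) e.
  by apply: (mulfI A1); rewrite -e mulr1.
have [m m0 [x Dx]] := integral_multiple y.
have [m' m'0 [x' Dx']] := integral_multiple z.
have mm0 : (0 < m * m')%N by rewrite muln_gt0 m0.
have Dw : integer_val (x * x') = (m * m')%:R * (y * z).
  rewrite integer_valM Dx Dx' natrM; ring.
have mA : (m * m')%:R * integer_val (A 1) != 0 by rewrite mulf_neq0 // num_field_natr_eq0 -lt0n.
apply: (mulfI mA); rewrite -(frac_AE mm0 Dw); apply: (mulfI A1).
rewrite -integer_valM A_multiplicative integer_valM (frac_AE m0 Dx) (frac_AE m'0 Dx') natrM; ring.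
Qed.

Lemma A_factor : exists (tau : {rmorphism K -> L}) (eps : 'O_L),
  forall x : 'O_K, integer_val (A x) = integer_val eps * tau (integer_val x).
Proof.
pose tau : {rmorphism K -> L} := HB.pack frac_A
  (GRing.isZmodMorphism.Build K L frac_A frac_A_zmod_morphism)
  (GRing.isMonoidMorphism.Build K L frac_A frac_A_monoid_morphism).
exists tau, (A 1) => x; rewrite (@frac_AE 1 x (integer_val x)) ?mul1r //.
Qed.

End LocalCondition.
End KFreeMaps.

Theorem theorem1p2 (K L : fieldExtType rat) (k l : nat)
    (hk : (2 <= k)%N) (hl : (2 <= l)%N) (A : {additive 'O_K -> 'O_L}) :
  let a := A @` kfree K k `<=` kfree L l in
  let b := forall p : nat, prime p -> forall x : 'O_K,
    kfree_mod K k p (residue (p ^ k) x) ->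
    kfree_mod L l p (residue (p ^ l) (A x)) in
  let c := exists (tau : {rmorphism K -> L}) (eps : 'O_L),
    forall x : 'O_K, integer_val (A x) = integer_val eps * tau (integer_val x) in
  (a <-> b) /\ (b -> c).
Proof.
have [BK] := exists_integral_basis K; have [BL] := exists_integral_basis L.
split; last exact: A_factor hk hl A BK BL.
by split; [exact: kfree_mod_of_kfree hk A BK | exact: kfree_of_kfree_mod BL].
Qed.
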